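(* Let $S$ be a countably infinite set with symmetric conductances $c_{x,y}=c_{y,x}\in[0,+\infty)$ satisfying Assumption SSEP, and let $\mathcal L$ with domain $\mathcal D(\mathcal L)$ be the Markov generator of the symmetric simple exclusion process with conductances $c_{x,y}$. Let $f\in C(\{0,1\}^S)$ satisfy $\sum_{x\in S}\Delta_f(x)<+\infty$ and $\sum_{x\in S}c_x\Delta_f(x)<+\infty$. Then $f\in\mathcal D(\mathcal L)$ and $$\mathcal L f(\eta)=\sum_{\{x,y\}\in\mathcal E_S}c_{x,y}\big[f(\eta^{x,y})-f(\eta)\big],$$ where the right-hand side is an absolutely convergent series of functions in $C(\{0,1\}^S)$.
   Context: Setting. $S$ is a countably infinite set, $\mathcal E_S:=\{\{x,y\}: x\ne y,\ x,y\in S\}$. To each $\{x,y\}\in\mathcal E_S$ is associated a number $c_{x,y}=c_{y,x}\in[0,+\infty)$; $c_{x,x}:=0$. Assumption SSEP: (C1) $c_x:=\sum_{y\in S}c_{x,y}<+\infty$ for all $x\in S$; (C2) for each $x\in S$ the continuous-time random walk on $S$ starting at $x$ with jump rates $c_{y,z}$ (at $y$ it waits an exponential time of mean $1/c_y\in(0,+\infty]$, then jumps to $z$ with probability $c_{y,z}/c_y$) a.s. does not explode. Path spaces. For a metric space $W$, $D_W=D(\mathbb R_+,W)$ is the space of càdlàg paths $\mathbb R_+=[0,+\infty)\to W$ with the Skorohod topology and its Borel $\sigma$-algebra. $\mathbb N=\{0,1,\dots\}$ is discrete; $\{0,1\}^S$ has the product topology. $D_{\mathbb N}^{\mathcal E_S}$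 has the product topology; its generic element is $\mathcal K=(\mathcal K_{x,y})_{\{x,y\}\in\mathcal E_S}$, with $\mathcal K_{x,y}=\mathcal K_{y,x}$. $\mathbb P$ (with expectation $\mathbb E$) is the law on $D_{\mathbb N}^{\mathcal E_S}$ of a family $(N_{x,y}(\cdot))_{\{x,y\}\in\mathcal E_S}$ of independent Poisson processes, $N_{x,y}$ having intensity $c_{x,y}$ and $N_{x,y}(0)=0$. Graphical construction. Let $\mathcal K_x(t):=\sum_{y\in S\setminus\{x\}}\mathcal K_{x,y}(t)$. $\Gamma$ is the set of $\mathcal K$ such that: (i) for all $x\in S$, $\mathcal K_x$ is finite-valued and càdlàg with jumps equal to $+1$; (ii) each $\mathcal K_{x,y}$ has only jumps equal to $+1$; (iii) for $\{x,y\}\neq\{x',y'\}$ the sets of jump times of $\mathcal K_{x,y}$ and $\mathcal K_{x',y'}$ are disjoint; (iv) $\mathcal K_{x,y}(0)=0$ for all $\{x,y\}$. For $\mathcal K\in\Gamma$, $t\ge0$, $x\in S$ define $X_t^x[\mathcal K]\in S\cup\{\partial\}$ ($\partial\notin S$ an abstract state): if $\mathcal K_x$ has no jump times in $[0,t]$, set $X^x_t[\mathcal K]:=x$; otherwise let $t_1$ be the largest jump time of $\mathcal K_x$ in $[0,t]$ and $x_1$ the unique site such that $t_1$ is a jump time of $\mathcal K_{x,x_1}$. Given $(t_k,x_k)$, $k\ge1$: if $\mathcal K_{x_k}$ has no jump times in $[0,t_k)$, set $X_t^x[\mathcal K]:=x_k$ and stop; otherwise let $t_{k+1}$ be the largest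 one and $x_{k+1}$ the unique site such that $t_{k+1}$ is a jump time of $\mathcal K_{x_k,x_{k+1}}$. If the algorithm never stops, $X_t^x[\mathcal K]:=\partial$. Let $\Gamma_*:=\{\mathcal K\in\Gamma: X_t^x[\mathcal K]\in S\ \forall x\in S,\ t\ge0\}$; it is Borel and $\mathbb P(\Gamma_* )=1$. For $\mathcal K\in\Gamma_*$ and $\sigma\in\{0,1\}^S$ set $\eta_t^\sigma[\mathcal K](x):=\sigma(X_t^x[\mathcal K])$. Semigroup and generator. $C(\{0,1\}^S)$ is the space of real continuous functions with the uniform norm. $S(t)f(\sigma):=\mathbb E[f(\eta^\sigma_t[\mathcal K])]$ defines a strongly continuous Markov semigroup on $C(\{0,1\}^S)$, the semigroup of the symmetric simple exclusion process (SSEP). Its generator $\mathcal L$ has domain $\mathcal D(\mathcal L)=\{f\in C(\{0,1\}^S): \lim_{t\downarrow0}(S(t)f-f)/t\text{ exists in }C(\{0,1\}^S)\}$ and $\mathcal L f$ is that limit. $\eta^{x,y}$ is obtained from $\eta$ by exchanging the values at $x$ and $y$. For $f\in C(\{0,1\}^S)$, $\Delta_f(x):=\sup\{|f(\eta)-f(\xi)|:\eta,\xi\in\{0,1\}^S,\ \eta(y)=\xi(y)\ \forall y\in S\setminus\{x\}\}$. Absolutely convergent series in $C(\{0,1\}^S)$: the sum of the uniform norms of the terms is finite. *)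

(* Defs.v *)
From HB Require Import structures.
From mathcomp Require Import all_boot all_order all_algebra finmap.
From mathcomp Require Import all_classical all_reals all_analysis.
From mathcomp Require Import measurable_realfun.
From mathcomp.analysis.showcase Require summability.

Set Implicit Arguments.
Unset Strict Implicit.
Unset Printing Implicit Defensive.

Import Order.TTheory GRing.Theory Num.Theory.
Import numFieldNormedType.Exports.

Local Open Scope classical_set_scope.
Local Open Scope ring_scope.

Definition edge (S : choiceType) := {e : {fset S} | #|` e|%fset == 2%N}.

(* The edge {x, y}; it is None exactly when x = y. *)
Definition edge_of (S : choiceType) (x y : S) : option (edge S) :=
  insub [fset x; y]%fset.

Lemma edge_endpoints (S : choiceType) (e : edge S) :
  exists p : S * S, (p.1 != p.2) && (val e == [fset p.1; p.2]%fset).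
Proof.
case: e => A /= /eqP A2.
have /fset0Pn[x xA] : A != fset0 by rewrite -cardfs_gt0 A2.
have /cardfs1P[y yE] : #|` A `\ x|%fset == 1%N.
  by have := cardfsD1 x A; rewrite xA A2 add1n => -[<-].
have /fsetD1P[yx _] : y \in (A `\ x)%fset by rewrite yE inE.
by exists (x, y); rewrite eq_sym yx -yE fsetD1K/=.
Qed.

(* The two sites of an edge, in an arbitrary order. *)
Definition endpoints (S : choiceType) (e : edge S) : S * S :=
  xchoose (edge_endpoints e).

Lemma edge_of_endpoints (S : choiceType) (e : edge S) :
  edge_of (endpoints e).1 (endpoints e).2 = Some e.
Proof.
have /andP[_ /eqP eE] := xchooseP (edge_endpoints e).
by rewrite /edge_of -eE valK.
Qed.

Lemma edge_ofC (S : choiceType) (x y : S) : edge_of x y = edge_of y x.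
Proof. by rewrite /edge_of fsetUC. Qed.

Lemma edge_of_refl (S : choiceType) (x : S) : edge_of x x = None.
Proof. by rewrite /edge_of insubN// fsetUid cardfs1. Qed.

Section rates.
Context {R : realType} {S : choiceType} (c : edge S -> R).

Definition conductance (x y : S) : R :=
  if edge_of x y is Some e then c e else 0.

Definition site_rate (x : S) : \bar R :=
  \esum_(y in [set: S]) (conductance x y)%:E.

(* A site of null rate is absorbing. *)
Definition jump_proba (y z : S) : R :=
  if fine (site_rate y) == 0 then (y == z)%:R
  else conductance y z / fine (site_rate y).

(* Y is the sequence of visited sites and tau the sequence of holding times:
   Y is a Markov chain from x with transition matrix jump_proba and, given Y,
   the holding times tau i are independent, tau i being exponential with
   parameter site_rate (Y i) (so that tau i = +oo a.s. if this rate is 0). *)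
Definition random_walk d (Omega : measurableType d) (P : probability Omega R)
    (x : S) (Y : nat -> Omega -> S) (tau : nat -> Omega -> \bar R) : Prop :=
  [/\ forall n y, measurable (Y n @^-1` [set y]),
      forall n, measurable_fun [set: Omega] (tau n),
      forall n w, (0 <= tau n w)%E &
      forall (n : nat) (y : nat -> S) (t : nat -> R), (forall i, 0 <= t i) ->
        P [set w | forall i, (i <= n)%N ->
                     Y i w = y i /\ ((t i)%:E < tau i w)%E] =
        ((y 0%N == x)%:R * \prod_(i < n) jump_proba (y i) (y i.+1) *
         \prod_(i < n.+1) expR (- (fine (site_rate (y i)) * t i)))%:E].

(* The law of the walk is determined by random_walk, so that any realization
   of the walk may be used. *)
Definition nonexplosive (x : S) : Prop :=
  exists (d : measure_display) (Omega : measurableType d)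
    (P : probability Omega R)
    (Y : nat -> Omega -> S) (tau : nat -> Omega -> \bar R),
    random_walk P x Y tau /\
    {ae P, forall w, (\sum_(0 <= n <oo) tau n w = +oo)%E}.

Definition assumption_SSEP : Prop :=
  (forall x, (site_rate x < +oo)%E) /\ (forall x, nonexplosive x).

End rates.

Section cadlag.
Context {R : realType}.

Definition cadlag (T : topologicalType) (f : R -> T) : Prop :=
  (forall t : R, 0 <= t -> f s @[s --> t^'+] --> f t) /\
  (forall t : R, 0 < t -> exists l : T, f s @[s --> t^'-] --> l).

Definition jump_time (f : R -> R) (t : R) : Prop :=
  0 < t /\ ~ (f s @[s --> t^'-] --> f t).

Definition unit_jumps (f : R -> R) : Prop :=
  forall t, jump_time f t -> f s @[s --> t^'-] --> f t - 1.

End cadlag.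

(* The space D(R_+, N). Paths are extended to t < 0 by their value at 0, so
   that an element is determined by its restriction to R_+. *)
Record skorokhod (R : realType) := Skorokhod {
  skorokhod_fun :> R -> nat ;
  skorokhod_neg : forall t : R, t < 0 -> skorokhod_fun t = skorokhod_fun 0 ;
  skorokhod_cadlag : cadlag skorokhod_fun }.

HB.instance Definition _ (R : realType) := gen_eqMixin (skorokhod R).
HB.instance Definition _ (R : realType) := gen_choiceMixin (skorokhod R).

Section skorokhod_topology.
Context {R : realType}.

Lemma cadlag_cst (T : topologicalType) (a : T) : cadlag (fun _ : R => a).
Proof.
by split=> [t _|t _]; [exact: cvg_cst|exists a; exact: cvg_cst].
Qed.

HB.instance Definition _ := isPointed.Build (skorokhod R)
  (@Skorokhod R (fun=> 0%N) (fun _ _ => erefl) (@cadlag_cst nat 0%N)).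

(* Increasing bijections of R_+ onto itself; they are automatically
   continuous. *)
Definition time_change (lambda : R -> R) : Prop :=
  set_bij [set t : R | 0 <= t] [set t : R | 0 <= t] lambda /\
  (forall s t : R, 0 <= s -> s < t -> lambda s < lambda t).

(* x_n -> x in D(R_+, N) iff for all T and eps > 0, eventually
   x_n \in skorokhod_ball x T eps: since N carries the discrete metric,
   uniform closeness of the values on [0, T] is equality. *)
Definition skorokhod_ball (x : skorokhod R) (T eps : R) : set (skorokhod R) :=
  [set y | exists2 lambda, time_change lambda &
     forall t : R, 0 <= t <= T -> `|lambda t - t| < eps /\ y t = x (lambda t)].

Definition skorokhod_open (U : set (skorokhod R)) : Prop :=
  forall x, U x -> exists T eps, 0 < eps /\ skorokhod_ball x T eps `<=` U.

Lemma skorokhod_openT : skorokhod_open setT.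
Proof. by move=> x _; exists 0, 1. Qed.

Lemma sub_skorokhod_ball x T T' eps eps' : T' <= T -> eps <= eps' ->
  skorokhod_ball x T eps `<=` skorokhod_ball x T' eps'.
Proof.
move=> TT ee y [l tl H]; exists l => // t /andP[t0 tT].
have [|le ->] := H t; first by rewrite t0 (le_trans tT).
by split=> //; exact: lt_le_trans ee.
Qed.

Lemma skorokhod_openI : setI_closed skorokhod_open.
Proof.
move=> U V oU oV x [/oU[T [e [e0 TU]]] /oV[T' [e' [e'0 TV]]]].
exists (Num.max T T'), (Num.min e e'); split; first by rewrite lt_min e0.
move=> y By; split; [apply: TU|apply: TV]; apply: sub_skorokhod_ball By;
  by rewrite ?le_max ?ge_min lexx ?orbT.
Qed.

Lemma skorokhod_open_bigU (I : Type) (f : I -> set (skorokhod R)) :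
  (forall i, skorokhod_open (f i)) -> skorokhod_open (\bigcup_i f i).
Proof.
move=> fo x [i _ /fo[T [e [e0 Tf]]]]; exists T, e; split=> //.
by move=> y /Tf; exists i.
Qed.

HB.instance Definition _ := isOpenTopological.Build (skorokhod R)
  skorokhod_openT skorokhod_openI skorokhod_open_bigU.

End skorokhod_topology.

Notation borel X := (g_sigma_algebraType (@open X)).

Definition path_space (R : realType) (S : choiceType) : Type :=
  prod_topology (fun _ : edge S => skorokhod R).

HB.instance Definition _ (R : realType) (S : choiceType) :=
  Pointed.on (path_space R S).
HB.instance Definition _ (R : realType) (S : choiceType) :=
  Topological.on (path_space R S).

Section poisson.
Context {R : realType}.

(* poisson_prob r _ is the Poisson distribution of parameter r, the Dirac mass
   at 0 if r = 0; its second argument is a dummy. *)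
Definition poisson_process d (Omega : measurableType d)
    (P : probability Omega R) (r : R) (N : Omega -> skorokhod R) : Prop :=
  [/\ P [set w | N w 0 = 0%N] = 1%E,
      forall (s t : R) (k : nat), 0 <= s -> s <= t ->
        P [set w | N w t = (N w s + k)%N] =
        poisson_prob (r * (t - s)) 0 [set k] &
      forall (n : nat) (t : nat -> R) (k : nat -> nat),
        0 <= t 0%N -> (forall i, t i <= t i.+1) ->
        P [set w | forall i, (i < n)%N -> N w (t i.+1) = (N w (t i) + k i)%N] =
        (\prod_(i < n)
           fine (P [set w | N w (t i.+1) = (N w (t i) + k i)%N]))%:E].

Definition mutually_independent d d' (Omega : measurableType d)
    (T : measurableType d') (P : probability Omega R) (I : choiceType)
    (X : I -> Omega -> T) : Prop :=
  forall (F : {fset I}) (B : I -> set T), (forall i, measurable (B i)) ->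
    P (\bigcap_(i in [set` F]) X i @^-1` B i) =
    (\prod_(i <- F) fine (P (X i @^-1` B i)))%:E.

Context {S : choiceType}.

Definition coordinate (e : edge S) (K : borel (path_space R S)) :
  borel (skorokhod R) := K e.

Definition poisson_law (c : edge S -> R)
    (P : probability (borel (path_space R S)) R) : Prop :=
  (forall e, poisson_process P (c e) (coordinate e)) /\
  mutually_independent P coordinate.

End poisson.

Definition config (S : choiceType) : Type := prod_topology (fun _ : S => bool).

HB.instance Definition _ (S : choiceType) := Topological.on (config S).

Section graphical_construction.
Context {R : realType} {S : choiceType}.
Implicit Types (K : path_space R S) (x y : S) (e : edge S) (t : R).

Definition edge_path K e (t : R) : R := (K e t)%:R.

Definition pair_path K x y (t : R) : R :=
  if edge_of x y is Some e then edge_path K e t else 0.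

Definition site_count K x t : \bar R :=
  \esum_(y in ~` [set x]) (pair_path K x y t)%:E.

Definition site_path K x (t : R) : R := fine (site_count K x t).

Definition Gamma : set (path_space R S) :=
  [set K | [/\ forall x, [/\ forall t : R, 0 <= t -> (site_count K x t < +oo)%E,
                             cadlag (site_path K x) &
                             unit_jumps (site_path K x)],
               forall e, unit_jumps (edge_path K e),
               forall e e', e != e' ->
                 forall t, ~ (jump_time (edge_path K e) t /\
                              jump_time (edge_path K e') t) &
               forall e, K e 0 = 0%N]].

Definition last_jump_in K x (A : set R) (s : R) : Prop :=
  [/\ A s, jump_time (site_path K x) s &
      forall r : R, A r -> jump_time (site_path K x) r -> r <= s].

(* backtrack K x A z: the algorithm started at x, with jump times first
   searched for in A, stops after finitely many steps at z. *)
Inductive backtrack K : S -> set R -> S -> Prop :=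
| backtrack_stop x A :
    (forall s, A s -> ~ jump_time (site_path K x) s) -> backtrack K x A x
| backtrack_jump x y z A s :
    last_jump_in K x A s -> jump_time (pair_path K x y) s ->
    backtrack K y `[0, s[%classic z -> backtrack K x A z.

(* None is the state \partial. *)
Definition flow K t x : option S :=
  xget None [set o | exists2 z, o = Some z & backtrack K x `[0, t]%classic z].

Definition Gamma_star : set (path_space R S) :=
  [set K | Gamma K /\ forall x (t : R), 0 <= t -> exists y, flow K t x = Some y].

(* The value false is never used for K in Gamma_star and t >= 0. *)
Definition exclusion K t (sigma : config S) : config S :=
  fun x => if flow K t x is Some y then sigma y else false.

End graphical_construction.

Section generator.
Context {R : realType} {S : choiceType}.
Variable P : probability (borel (path_space R S)) R.
Implicit Types f g : config S -> R.

Definition sup_norm f : \bar R :=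
  ereal_sup [set `|f eta|%:E | eta in [set: config S]].

Definition semigroup (t : R) f : config S -> R :=
  fun sigma => \int[P]_(K in Gamma_star) f (exclusion K t sigma).

Definition generator_limit f g : Prop :=
  [/\ continuous f, continuous g &
      sup_norm (fun eta => (semigroup t f eta - f eta) / t - g eta)
        @[t --> (0 : R)^'+] --> 0%E].

Definition generator_domain : set (config S -> R) :=
  [set f | exists g, generator_limit f g].

(* Meaningful for f in generator_domain. *)
Definition generator f : config S -> R :=
  xget (fun=> 0) [set g | generator_limit f g].

End generator.

Section series.
Context {R : realType} {S I : choiceType}.
Implicit Type u : I -> config S -> R.

Definition absolutely_convergent u : Prop :=
  (forall i, continuous (u i)) /\ (\esum_(i in [set: I]) sup_norm (u i) < +oo)%E.

(* g is the sum of the series u for the uniform norm, over finite subsets of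
   the index set. *)
Definition series_sum u (g : config S -> R) : Prop :=
  sup_norm (fun eta => \sum_(i <- F) u i eta - g eta)
    @[F --> @summability.totally I] --> 0%E.

End series.

Definition exchange (S : choiceType) (x y : S) (eta : config S) : config S :=
  fun z => if z == x then eta y else if z == y then eta x else eta z.

Lemma exchangeC (S : choiceType) (x y : S) : exchange x y = exchange y x.
Proof.
apply/funext => eta; apply/funext => z; rewrite /exchange.
by case: eqVneq => [->|]; case: eqVneq => [->|].
Qed.

Definition edge_exchange (S : choiceType) (e : edge S) : config S -> config S :=
  exchange (endpoints e).1 (endpoints e).2.

Definition site_variation (R : realType) (S : choiceType) (f : config S -> R)
    (x : S) : \bar R :=
  ereal_sup [set `|f p.1 - f p.2|%:E |
    p in [set p : config S * config S | forall y, y != x -> p.1 y = p.2 y]].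

Definition exclusion_term (R : realType) (S : choiceType) (c : edge S -> R)
    (f : config S -> R) (e : edge S) : config S -> R :=
  fun eta => c e * (f (edge_exchange e eta) - f eta).

(* Main.v *)
Require Import Defs.
From mathcomp Require Import all_boot all_order all_algebra finmap.
From mathcomp Require Import all_classical all_reals all_analysis.
From mathcomp Require Import measurable_realfun lra ring zify.
From mathcomp.analysis.showcase Require summability.

Import Order.TTheory GRing.Theory Num.Theory.
Import numFieldNormedType.Exports.

Set Implicit Arguments.
Unset Strict Implicit.
Unset Printing Implicit Defensive.

Local Open Scope classical_set_scope.
Local Open Scope ring_scope.

(** The semigroup integrates over the families of paths for which
    backtracking stops, so the proof has two halves: backtracking stops
    almost surely, and S(t) f has a first-order expansion in t, uniform in
    the configuration.

    Termination. Outside a null set the Poisson paths are [regular], and for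
    regular families jumps are handled by elementary arguments on
    integer-valued step functions. If backtracking from (x, t) never stops,
    the same holds from (x, q) for some rational q > t ([nonstop_rational]),
    so countably many starting points suffice. Backward in time the
    trajectory is a random walk with rates c. Instead of identifying the two
    laws, one fixes a finite path x, y_1, ..., y_n and shows that the outer
    probability that backtracking follows it is at most the probability that
    the walk follows it and makes these n jumps by time q
    ([chain_outer_measure]). For this [0, q] is cut into m cells. Unless
    some cell contains two jumps of a given finite set of edges, which has
    probability O(1/m), the trajectory is described by the numbers of cells
    spent at the successive sites ([chain_word]). The increments are
    independent, so the probability of such a description is explicit; up to
    a factor close to 1 it is at most the probability that the holding times
    of the walk lie in the corresponding cells ([step_le]), and the latter
    events are disjoint ([walk_weight_sum]). Summing over paths, a
    trajectory that never stops has outer probability at most that of n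
    jumps of the walk by time q, for every n; this tends to 0 because the
    walk does not explode ([Gamma_star_ae]).

    Generator. Let Delta_e be the sum of the variations of f at the two
    endpoints of e. Double counting turns the second summability hypothesis
    into the summability of c_e Delta_e, which dominates the norms of the
    terms of the series. Fix a finite set F of edges. With probability 1 -
    O(t^2) ([crowded_prob]), an edge of F that has jumped by time t has
    jumped once, and neither another edge of F nor an adjacent edge has
    jumped; then f(eta_t) is f(sigma) or f(sigma^e), except for sites
    touched by a jump of an edge outside F, which cost at most the sum of
    Delta_e over these edges ([expansion_remainder]). Taking expectations,
    S(t) f - f differs from t times the partial sum over F by at most t
    times the tail of the series plus O(t^2), uniformly in sigma
    ([semigroup_expansion]); divide by t, let t tend to 0 and F increase.
    The measurability of f(eta_t) never enters: the integrand is squeezed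
    between integrable functions ([integral_sandwich]). *)

(** * Edges *)

Section edges.
Context {S : choiceType}.
Implicit Types (x y z : S) (e : edge S).

Lemma edge_of_val x y e : edge_of x y = Some e -> val e = [fset x; y]%fset.
Proof. by rewrite /edge_of; case: insubP => //= e' _ <- [->]. Qed.

Lemma val_endpoints e : val e = [fset (endpoints e).1; (endpoints e).2]%fset.
Proof. exact: edge_of_val (edge_of_endpoints e). Qed.

Lemma endpoints_neq e : (endpoints e).1 != (endpoints e).2.
Proof. by have /andP[] := xchooseP (edge_endpoints e). Qed.

(** The transposition of the two endpoints of e; edge_exchange e is the
    composition with it. *)
Definition other e x : S :=
  if x == (endpoints e).1 then (endpoints e).2
  else if x == (endpoints e).2 then (endpoints e).1 else x.

Lemma edge_exchangeE e (eta : config S) x :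
  edge_exchange e eta x = eta (other e x).
Proof. by rewrite /edge_exchange /exchange /other; case: eqP => //; case: eqP. Qed.

Lemma in_edge e x :
  (x \in val e) = (x == (endpoints e).1) || (x == (endpoints e).2).
Proof. by rewrite val_endpoints !inE. Qed.

Lemma other_notin e x : x \notin val e -> other e x = x.
Proof. by rewrite in_edge negb_or /other => /andP[/negbTE-> /negbTE->]. Qed.

Lemma edge_of_other e x : x \in val e -> edge_of x (other e x) = Some e.
Proof.
rewrite in_edge /other; case: eqVneq => [->|_] /=.
  by rewrite edge_of_endpoints.
by case: eqVneq => // -> _; rewrite edge_ofC edge_of_endpoints.
Qed.

Lemma other_neq e x : x \in val e -> other e x != x.
Proof.
move=> /edge_of_other; case: eqVneq => // ->.
by rewrite edge_of_refl.
Qed.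

Lemma edge_of_mem x y e : edge_of x y = Some e -> x \in val e.
Proof. by move=> /edge_of_val ->; rewrite !inE eqxx. Qed.

Lemma edge_of_memr x y e : edge_of x y = Some e -> y \in val e.
Proof. by rewrite edge_ofC => /edge_of_mem. Qed.

Lemma edge_of_otherE x y e : edge_of x y = Some e -> other e x = y.
Proof.
move=> exy; have xe := edge_of_mem exy.
have := other_neq xe; have := edge_of_val (edge_of_other xe).
rewrite (edge_of_val exy) => /fsetP/(_ (other e x)).
by rewrite !inE eqxx orbT => /orP[/eqP->|/eqP//]; rewrite eqxx.
Qed.

(** Independence is a statement about edges, while site_rate and site_count
    range over neighbours. *)
Lemma esum_site {R : realType} (a : edge S -> \bar R) x :
  (\esum_(y in ~` [set x]) (if edge_of x y is Some e then a e else 0) =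
   \esum_(e in [set e : edge S | x \in val e]) a e)%E.
Proof.
rewrite (reindex_esum [set e : edge S | x \in val e] (~` [set x]) (other^~ x)).
  by apply: eq_esum => e /= xe; rewrite edge_of_other.
split=> [e /= xe|e e'|y /= /eqP yx].
- exact/eqP/other_neq.
- rewrite !inE => xe xe' ee'.
  by have := edge_of_other xe; rewrite ee' (edge_of_other xe') => -[].
- case exy: (edge_of x y) => [e|].
    by exists e; [exact: edge_of_mem exy|exact: edge_of_otherE exy].
  have xy2 : #|` [fset x; y]|%fset == 2%N by rewrite cardfs2 (eq_sym x) yx.
  by move: exy; rewrite /edge_of (insubT (fun A => #|` A|%fset == 2%N) xy2).
Qed.

End edges.

(** * Nondecreasing paths with values in the naturals *)

Section counting_paths.
Context {R : realType}.
Implicit Types (g : R -> nat) (s t : R).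

Definition nondecreasing_path g :=
  forall s t, 0 <= s -> s <= t -> (g s <= g t)%N.

Definition right_constant g :=
  forall t, 0 <= t -> exists2 d, 0 < d & forall s, t <= s -> s < t + d -> g s = g t.

(** For monotone integer-valued paths this is the discontinuity of jump_time
    ([jump_timeP]), in a form that passes to sums of paths. *)
Definition jump g s := 0 < s /\ forall r, 0 <= r -> r < s -> (g r < g s)%N.

Lemma right_constant_skorokhod (x : skorokhod R) : right_constant x.
Proof.
move=> t t0; have [/(_ t t0) + _] := skorokhod_cadlag x.
move=> /(_ [set x t]) H.
have : nbhs (x t) [set x t] by [].
move=> /H [d /= d0 Hd]; exists d => // s; rewrite le_eqVlt => /orP[/eqP->//|ts std].
by apply: Hd => //=; rewrite ltr_norml; lra.
Qed.

(** The infimum of the times at which g has reached g t is a minimum by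
    right-continuity.  All jumps are produced from it. *)
Lemma first_passage g t : nondecreasing_path g -> right_constant g -> 0 <= t ->
  exists s, [/\ 0 <= s, s <= t, g s = g t &
                forall r, 0 <= r -> r < s -> (g r < g s)%N].
Proof.
move=> gm gr t0; pose E := [set s | 0 <= s /\ (g t <= g s)%N].
have Et : E t by [].
have hE : has_inf E by split; [exists t|exists 0 => s []].
have E0 : 0 <= inf E by apply: lb_le_inf; [exists t|move=> s []].
have Elt : inf E <= t by apply: ge_inf => //; exact: hE.2.
have gE : (g t <= g (inf E))%N.
  have [d d0 Hd] := gr _ E0.
  have [s [s0 gs] sd] := inf_adherent d0 hE.
  by rewrite -(Hd s)//; apply: ge_inf => //; exact: hE.2.
exists (inf E); split=> //.
  by apply/eqP; rewrite eqn_leq gE gm.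
move=> r r0 rE; apply: leq_trans gE; rewrite ltnNge; apply: contraL rE => gr'.
by rewrite -leNgt; apply: ge_inf => //; exact: hE.2.
Qed.

Lemma jump_exists g a b : nondecreasing_path g -> right_constant g -> 0 <= a ->
  a <= b -> (g a < g b)%N -> exists2 s, a < s <= b & jump g s.
Proof.
move=> gm gr a0 ab gab; have b0 := le_trans a0 ab.
have [s [s0 sb gs H]] := first_passage gm gr b0.
have as_ : a < s by rewrite ltNge; apply: contraL gab => /(gm _ _ s0); rewrite gs -leqNgt.
by exists s; [rewrite as_|split=> //; exact: le_lt_trans as_].
Qed.

(** A nondecreasing integer-valued path is bounded before t, hence takes there a
    largest value, from which it cannot move until t. *)
Lemma left_limit g t : nondecreasing_path g -> 0 < t ->
  exists r, [/\ 0 <= r, r < t & forall s, r <= s -> s < t -> g s = g r].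
Proof.
move=> gm t0; pose Q n := `[< exists2 r, 0 <= r < t & g r = n >].
have exQ : exists n, Q n by exists (g 0); apply/asboolP; exists 0; rewrite ?lexx.
have Qb n : Q n -> (n <= g t)%N.
  by move=> /asboolP[r /andP[r0 rt] <-]; exact: gm (ltW _).
case: (ex_maxnP exQ Qb) => n /asboolP[r /andP[r0 rt] <-] Hn.
exists r; split=> // s rs st; apply/eqP; rewrite eqn_leq (gm r)// andbT.
by apply: Hn; apply/asboolP; exists s => //; rewrite (le_trans r0).
Qed.

Lemma cvg_left_const (f : R -> R) (v : R) r s : r < s ->
  (forall u, r <= u -> u < s -> f u = v) -> f u @[u --> s^'-] --> v.
Proof.
move=> rs H; apply: cvg_near_cst; exists (s - r) => /=; first lra.
move=> u /= + us; rewrite ltr_norml => /andP[_ ur].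
by apply: H => //; lra.
Qed.

Lemma jump_timeP (f : R -> R) g s : nondecreasing_path g ->
  (forall u, 0 <= u -> u <= s -> f u = (g u)%:R) -> jump_time f s <-> jump g s.
Proof.
move=> gm fg; split=> -[s0 H]; split=> //.
  move=> r r0 rs; rewrite ltnNge; apply/negP => grs; apply: H.
  apply: (@cvg_left_const _ _ r) => // u ru us.
  rewrite !fg ?(ltW us)// ?(ltW s0)//; last exact: le_trans ru.
  congr (_%:R); apply/eqP; rewrite eqn_leq (gm u s) ?(ltW us)//=; last exact: le_trans ru.
  by apply: (leq_trans grs); exact: gm.
have [r [r0 rs gr]] := left_limit gm s0.
have cr : f u @[u --> s^'-] --> ((g r)%:R : R).
  apply: (@cvg_left_const _ _ r) => // u ru us.
  by rewrite fg ?gr ?(ltW us)//; exact: le_trans ru.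
move=> cs; have := cvg_unique (@norm_hausdorff _ _) cr cs.
rewrite fg ?lexx ?(ltW s0)// => /(_ _)/eqP; rewrite eqr_nat => /eqP e.
by have := H r r0 rs; rewrite e ltnn.
Qed.

End counting_paths.

(** * Grids *)

Section grids.
Context {R : realType}.

Definition grid (q : R) (m i : nat) : R := q * i%:R / m%:R.

Lemma grid0 q m : grid q m 0 = 0. Proof. by rewrite /grid mulr0 mul0r. Qed.

Lemma grid_last q m : (0 < m)%N -> grid q m m = q.
Proof. by move=> m0; rewrite /grid mulfK// pnatr_eq0 -lt0n. Qed.

Lemma grid_le q m i j : 0 <= q -> (i <= j)%N -> grid q m i <= grid q m j.
Proof.
by move=> q0 ij; rewrite /grid ler_wpM2r ?invr_ge0// ler_wpM2l// ler_nat.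
Qed.

Lemma grid_ge0 q m i : 0 <= q -> 0 <= grid q m i.
Proof. by move=> q0; rewrite -(grid0 q m) grid_le. Qed.

Lemma gridS q m i : grid q m i.+1 - grid q m i = q / m%:R.
Proof. by rewrite /grid -mulrBl -mulrBr -natrB// subSnn mulr1. Qed.

Lemma grid_cell q m p s : 0 <= q -> 0 < s -> s <= grid q m p ->
  exists2 i, (i < p)%N & grid q m i < s <= grid q m i.+1.
Proof.
move=> q0 s0; elim: p => [|p IH]; first by rewrite grid0 => /(lt_le_trans s0); rewrite ltxx.
move=> sp; have [/IH[i ip H]|ps] := leP s (grid q m p).
  by exists i => //; exact: ltnW.
by exists p => //; rewrite ps.
Qed.

End grids.

(** * Regular families of paths *)

Section regular_paths.
Context {R : realType} {S : choiceType}.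
Implicit Types (K : path_space R S) (x y : S) (e : edge S) (s t : R).

Definition no_double_jump K e e' (a b : R) : Prop :=
  (K e b <= (K e a).+1)%N /\ (e != e' -> K e a = K e b \/ K e' a = K e' b).

(** Sample path properties that hold almost surely and imply Gamma.
    Simultaneous and double jumps are excluded by grids rather than at the jump
    times, since for a given grid this has an explicit probability. *)
Record regular K : Prop := Regular {
  regular0 : forall e, K e 0 = 0%N ;
  regular_nondecreasing : forall e, nondecreasing_path (K e) ;
  regular_finite : forall x (T : nat),
    finite_set [set e : edge S | x \in val e /\ K e T%:R <> 0%N] ;
  regular_simple : forall e e' (T : nat), exists2 m : nat, (0 < m)%N &
    forall j, (j < m)%N ->
      no_double_jump K e e' (grid T%:R m j) (grid T%:R m j.+1) }.

(** For regular families site_path takes natural values ([site_pathE]);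
    truncation reads them off uniformly in time, whereas the finite sums of
    [siteN_sum] only hold up to a given time. *)
Definition siteN K x t : nat := Num.truncn (site_path K x t).

Lemma left_common (I : eqType) (F : seq I) (Q : I -> R -> Prop) s : 0 < s ->
  (forall i, i \in F -> exists r, [/\ 0 <= r, r < s &
     forall u, r <= u -> u < s -> Q i u]) ->
  exists r, [/\ 0 <= r, r < s & forall u, r <= u -> u < s -> forall i, i \in F -> Q i u].
Proof.
move=> s0; elim: F => [|i F IH] H; first by exists 0; split.
have [r [r0 rs Hr]] : exists r, [/\ 0 <= r, r < s &
    forall u, r <= u -> u < s -> forall i, i \in F -> Q i u].
  by apply: IH => j jF; apply: H; rewrite inE jF orbT.
have [r' [r'0 r's Hr']] := H i (mem_head _ _).
exists (Num.max r r'); split.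
- by rewrite le_max r0.
- by rewrite gt_max rs.
- move=> u; rewrite ge_max => /andP[ru r'u] us j; rewrite inE => /orP[/eqP->|].
    exact: Hr'.
  exact: Hr.
Qed.

Section fix_K.
Variables (K : path_space R S) (regK : regular K).

(** Finite truncations of the set of edges at x, valid up to time T; they make
    site_count a finite sum. *)
Definition covers_site x T (F : {fset edge S}) :=
  (forall e, e \in F -> x \in val e) /\
  (forall e t, x \in val e -> e \notin F -> 0 <= t -> t <= T -> K e t = 0%N).

Lemma covers_site_exists x T : exists F, covers_site x T F.
Proof.
pose n := Num.bound `|T|.
have Tn : T <= n%:R by rewrite ltW// (le_lt_trans (ler_norm _))// archi_boundP.
exists (fset_set [set e : edge S | x \in val e /\ K e n%:R <> 0%N]).
have fin := regular_finite regK x n.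
split=> [e|e t xe]; rewrite in_fset_set//; first by rewrite inE => -[].
move=> /negP H t0 tT; apply/eqP; apply: contrapT => Ket; apply: H; apply/mem_set.
split=> //; have := regular_nondecreasing regK e t0 (le_trans tT Tn).
by move=> /[swap] ->; rewrite leqn0.
Qed.

Lemma site_count_sum x T F t : covers_site x T F -> 0 <= t -> t <= T ->
  site_count K x t = ((\sum_(e <- F) K e t)%N%:R)%:E.
Proof.
move=> [Fx FT] t0 tT; rewrite /site_count.
rewrite (_ : (fun y => (pair_path K x y t)%:E) = fun y =>
  (if edge_of x y is Some e then (edge_path K e t)%:E else 0)%E); last first.
  by apply/funext => y; rewrite /pair_path; case: edge_of.
rewrite (esum_site (fun e => (edge_path K e t)%:E) x).
rewrite (_ : \esum_(e in _) _ = \esum_(e in [set` F]) (edge_path K e t)%:E)%E; last first.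
  rewrite esum_mkcond [RHS]esum_mkcond; apply: eq_esum => e _.
  have [eF|eF] := boolP (e \in F).
    by rewrite !ifT// inE//=; exact: Fx.
  rewrite [RHS]ifF; last by apply/negbTE/negP; rewrite inE/= (negbTE eF).
  by case: ifPn => //; rewrite inE/= => xe; rewrite /edge_path (FT e).
rewrite esum_fset//; last by move=> e _; rewrite lee_fin /edge_path.
rewrite fsbig_finite//= set_fsetK natr_sum -sumEFin.
exact: eq_bigr.
Qed.

Lemma siteN_sum x T F t : covers_site x T F -> 0 <= t -> t <= T ->
  siteN K x t = (\sum_(e <- F) K e t)%N.
Proof.
by move=> cF t0 tT; rewrite /siteN /site_path (site_count_sum cF)//= natrK.
Qed.

Lemma site_pathE x t : 0 <= t -> site_path K x t = (siteN K x t)%:R.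
Proof.
have [F cF] := covers_site_exists x t.
by move=> t0; rewrite (siteN_sum cF)// /site_path (site_count_sum cF).
Qed.

Lemma siteN_nondecreasing x : nondecreasing_path (siteN K x).
Proof.
move=> s t s0 st; have [F cF] := covers_site_exists x t.
rewrite (siteN_sum cF s0 st) (siteN_sum cF (le_trans s0 st) (lexx t)).
by apply: leq_sum => e _; exact: regular_nondecreasing.
Qed.

Lemma siteN_right_constant x : right_constant (siteN K x).
Proof.
move=> t t0; have [F cF] := covers_site_exists x (t + 1).
have [d d0 H] : exists2 d, 0 < d & forall s, t <= s -> s < t + d ->
    forall e, e \in enum_fset F -> K e s = K e t.
  elim: (enum_fset F) => [|e l [d d0 Hd]]; first by exists 1.
  have [d' d'0 Hd'] := right_constant_skorokhod (K e) t0.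
  exists (Num.min d d'); first by rewrite lt_min d0.
  move=> s ts; rewrite addr_minr lt_min => /andP[sd sd'] e'.
  by rewrite inE => /orP[/eqP->|]; [exact: Hd'|exact: Hd].
exists (Num.min d 1); first by rewrite lt_min d0 ltr01.
move=> s ts; rewrite addr_minr lt_min => /andP[sd s1].
have s1' : s <= t + 1 by exact: ltW.
have t1 : t <= t + 1 by rewrite lerDl.
rewrite (siteN_sum cF (le_trans t0 ts) s1') (siteN_sum cF t0 t1).
by apply: eq_big_seq => e eF; exact: H.
Qed.

Lemma no_jump_left e s : 0 < s -> ~ jump (K e) s -> exists r,
  [/\ 0 <= r, r < s & forall u, r <= u -> u < s -> K e u = K e s].
Proof.
move=> s0 nj; have [r [r0 rs Hr]] : exists r, [/\ 0 <= r, r < s & (K e s <= K e r)%N].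
  apply: contrapT => H; apply: nj; split=> // r r0 rs; rewrite ltnNge.
  by apply/negP => sr; apply: H; exists r.
exists r; split=> // u ru us; apply/eqP; rewrite eqn_leq.
rewrite (regular_nondecreasing regK e (le_trans r0 ru) (ltW us)).
apply: leq_trans Hr _; exact: (regular_nondecreasing regK).
Qed.

Lemma jump_cell e e' s : 0 < s -> exists a b,
  [/\ 0 <= a, a < s, s <= b & no_double_jump K e e' a b].
Proof.
move=> s0; pose n := Num.bound `|s|.
have sn : s <= n%:R by rewrite ltW// (le_lt_trans (ler_norm _))// archi_boundP.
have [m m0 H] := regular_simple regK e e' n.
have [|j jm /andP[js sj]] := @grid_cell _ n%:R m m s (ler0n _ _) s0.
  by rewrite grid_last.
by exists (grid n%:R m j), (grid n%:R m j.+1); split=> //;[exact: grid_ge0|exact: H].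
Qed.

Lemma jump_inj e e' s : jump (K e) s -> jump (K e') s -> e = e'.
Proof.
move=> [s0 je] [_ je']; apply/eqP; apply/negPn/negP => ee'.
have [a [b [a0 as_ sb [_ /(_ ee')]]]] := jump_cell e e' s0.
have b0 : s <= b -> forall f, (K f s <= K f b)%N.
  by move=> _ f; apply: regular_nondecreasing => //; exact: ltW.
case=> H.
  by have := je a a0 as_; rewrite H ltnNge b0.
by have := je' a a0 as_; rewrite H ltnNge b0.
Qed.

Lemma jump_unit e s : jump (K e) s -> exists r,
  [/\ 0 <= r, r < s & forall u, r <= u -> u < s -> K e s = (K e u).+1].
Proof.
move=> [s0 je]; have [a [b [a0 as_ sb [H _]]]] := jump_cell e e s0.
exists a; split=> // u au us; apply/eqP; rewrite eqn_leq je ?(le_trans a0)// andbT.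
apply: (@leq_trans (K e b)); first by apply: regular_nondecreasing => //; exact: ltW.
by apply: (leq_trans H); rewrite ltnS; exact: regular_nondecreasing.
Qed.

Lemma edge_jump_timeP e s : jump_time (edge_path K e) s <-> jump (K e) s.
Proof. by apply: jump_timeP => //; exact: regular_nondecreasing. Qed.

Lemma site_jump_timeP x s : jump_time (site_path K x) s <-> jump (siteN K x) s.
Proof.
apply: jump_timeP; first exact: siteN_nondecreasing.
by move=> u u0 _; rewrite site_pathE.
Qed.

Lemma pair_jump_timeP x y s : jump_time (pair_path K x y) s <->
  exists2 e, edge_of x y = Some e & jump (K e) s.
Proof.
rewrite /pair_path; case: edge_of => [e|]; last first.
  by split=> [[_]|[]//]; elim; exact: cvg_cst.
split=> [/edge_jump_timeP|[_ [<-] /edge_jump_timeP]//]; by exists e.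
Qed.

(** If no edge at x jumps at s, the finitely many edges that matter before s are
    simultaneously constant just before s. *)
Lemma siteN_jumpE x s : jump (siteN K x) s <->
  exists2 e : edge S, x \in val e & jump (K e) s.
Proof.
have [F cF] := covers_site_exists x s; split=> [[s0 js]|[e xe je]]; last first.
  have s0 := je.1; split=> // r r0 rs.
  have eF : e \in F.
    apply: contraT => /(cF.2 _ s xe); rewrite (ltW s0) lexx => /(_ isT isT) Hs.
    by have := je.2 r r0 rs; rewrite Hs.
  rewrite (siteN_sum cF r0 (ltW rs)) (siteN_sum cF (ltW s0) (lexx s)).
  rewrite (big_fsetD1 e)//= [X in (_ < X)%N](big_fsetD1 e)//=.
  rewrite -addSn leq_add//; first exact: je.2.
  by apply: leq_sum => e' _; apply: (regular_nondecreasing regK) => //; exact: ltW.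
apply: contrapT => nj.
have [r [r0 rs H]] : exists r, [/\ 0 <= r, r < s &
    forall u, r <= u -> u < s -> forall e, e \in enum_fset F -> K e u = K e s].
  apply: left_common => // e eF; apply: no_jump_left => // je.
  by apply: nj; exists e => //; exact: cF.1.
have := js r r0 rs.
rewrite (siteN_sum cF r0 (ltW rs)) (siteN_sum cF (ltW s0) (lexx s)).
rewrite (eq_big_seq (K^~ s)) ?ltnn// => e eF; exact: H.
Qed.

Lemma siteN_jump_unit x s : jump (siteN K x) s -> exists r,
  [/\ 0 <= r, r < s & forall u, r <= u -> u < s -> siteN K x s = (siteN K x u).+1].
Proof.
move=> js; have s0 := js.1; have [e xe je] := (siteN_jumpE x s).1 js.
have [F cF] := covers_site_exists x s.
have eF : e \in F.
  apply: contraT => /(cF.2 _ s xe); rewrite (ltW s0) lexx => /(_ isT isT) Hs.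
  by have := je.2 0 (lexx _) s0; rewrite Hs.
have [r [r0 rs H]] : exists r, [/\ 0 <= r, r < s &
    forall u, r <= u -> u < s -> forall e', e' \in enum_fset F ->
      K e' s = (K e' u + (e' == e))%N].
  apply: left_common => // e' e'F; case: eqVneq => [->|e'e].
    have [r [r0 rs H]] := jump_unit je; exists r; split=> // u ru us.
    by rewrite addn1 (H u).
  have nj : ~ jump (K e') s by move=> je'; move: e'e; rewrite (jump_inj je' je) eqxx.
  have [r [r0 rs H]] := no_jump_left s0 nj; exists r; split=> // u ru us.
  by rewrite addn0 H.
exists r; split=> // u ru us.
rewrite (siteN_sum cF (ltW s0) (lexx s)) (siteN_sum cF (le_trans r0 ru) (ltW us)).
rewrite (eq_big_seq (fun e' => K e' u + (e' == e))%N)/=; last exact: H.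
rewrite big_split/= -[RHS]addn1; congr addn.
rewrite (big_fsetD1 e)//= eqxx big_seq big1 ?addn0// => e'.
by rewrite !inE => /andP[/negbTE->].
Qed.

Lemma regular_Gamma : Gamma K.
Proof.
split.
- move=> x; split.
  + move=> t t0; have [F cF] := covers_site_exists x t.
    by rewrite (site_count_sum cF)// ltry.
  + split=> [t t0|t t0].
      have [d d0 H] := siteN_right_constant x t0.
      rewrite site_pathE//; apply: cvg_near_cst; exists d => //= s.
      rewrite /= ltr_norml => /andP[s1 _] ts; rewrite site_pathE ?H ?(ltW ts)//.
        lra.
      by rewrite (le_trans t0)// ltW.
    have [r [r0 rt H]] := left_limit (@siteN_nondecreasing x) t0.
    exists (siteN K x r)%:R; apply: (@cvg_left_const _ _ _ r) => // u ru ut.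
    by rewrite site_pathE ?H//; exact: le_trans ru.
  + move=> t /site_jump_timeP jt; have [r [r0 rt H]] := siteN_jump_unit jt.
    apply: (@cvg_left_const _ _ _ r) => // u ru ut.
    rewrite !site_pathE ?(ltW jt.1)//; last exact: le_trans ru.
    by rewrite (H u)// -addn1 natrD addrK.
- move=> e t /edge_jump_timeP jt; have [r [r0 rt H]] := jump_unit jt.
  apply: (@cvg_left_const _ _ _ r) => // u ru ut.
  by rewrite /edge_path (H u)// -addn1 natrD addrK.
- move=> e e' ee' t [/edge_jump_timeP je /edge_jump_timeP je'].
  by move: ee'; rewrite (jump_inj je je') eqxx.
- exact: regular0.
Qed.

End fix_K.
End regular_paths.

(** * The backtracking algorithm on regular families *)

Section backtracking.
Context {R : realType} {S : choiceType}.
Implicit Types (K : path_space R S) (x y z : S) (e : edge S) (s t : R).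

(** The first steps of a backtracking trajectory; unlike backtrack, it does not
    ask that the algorithm stop. *)
Fixpoint chain K x (ys : seq S) (A : set R) : Prop :=
  if ys is y :: ys' then
    exists s, [/\ last_jump_in K x A s, jump_time (pair_path K x y) s &
                  chain K y ys' `[0, s[%classic]
  else True.

Variables (K : path_space R S) (regK : regular K).

(** The time sets met by the algorithm: the initial one, then those following a
    jump. *)
Definition past (A : set R) : Prop :=
  (exists2 t, 0 <= t & A = `[0, t]%classic) \/
  (exists2 t, 0 < t & A = `[0, t[%classic).

(** The path is constant just before an open end point, which reduces [0, t[ to
    a closed interval; there the last jump is the first passage at the final
    value. *)
Lemma last_jump_exists x A : past A ->
  (forall s, A s -> ~ jump_time (site_path K x) s) \/
  exists s, last_jump_in K x A s.
Proof.
have gm := @siteN_nondecreasing _ _ _ regK x.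
have gr := @siteN_right_constant _ _ _ regK x.
have closed t : 0 <= t -> forall B : set R,
    (forall u, B u <-> (0 <= u <= t \/ (0 <= u /\ B u /\ ~ jump (siteN K x) u))) ->
    (forall s, B s -> ~ jump_time (site_path K x) s) \/ exists s, last_jump_in K x B s.
  move=> t0 B HB; have [s [s0 st gs H]] := first_passage gm gr t0.
  have late r : B r -> s < r -> ~ jump (siteN K x) r.
    move=> /HB[/andP[r0 rt]|[_ []//]] sr [_ /(_ s s0 sr)].
    by rewrite gs ltnNge gm.
  move: s0; rewrite le_eqVlt => /orP[/eqP s0|s0].
    left=> r Br /(site_jump_timeP regK) jr; apply: (late r) => //.
    by rewrite -s0; exact: jr.1.
  right; exists s; split.
  - by apply/HB; left; rewrite st ltW.
  - by apply/(site_jump_timeP regK).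
  - move=> r Br /(site_jump_timeP regK) jr; rewrite leNgt; apply/negP => /(late r Br).
    exact.
case=> -[t t0 ->].
  apply: (closed t) => // u; rewrite /= in_itv/=; split; [by left|].
  by case=> // -[_ []].
have [r [r0 rt H]] := left_limit gm t0.
apply: (closed r) => // u; rewrite /= in_itv/=; split.
  move=> /andP[u0 ut]; have [ur|ru] := leP u r; first by left; rewrite u0.
  right; split=> //; rewrite u0 ut; split=> // -[_ /(_ r r0 ru)].
  by rewrite (H u) ?(ltW ru)// ltnn.
case=> [/andP[u0 ur]|[u0 [-> _]]//].
by rewrite u0 (le_lt_trans ur).
Qed.

Lemma last_jump_edge x A s : last_jump_in K x A s ->
  exists2 y, jump_time (pair_path K x y) s &
    exists2 e, edge_of x y = Some e & jump (K e) s.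
Proof.
move=> [_ /(site_jump_timeP regK)/(siteN_jumpE regK)[e xe je] _].
exists (other e x); last by exists e => //; exact: edge_of_other.
by apply/(pair_jump_timeP regK); exists e => //; exact: edge_of_other.
Qed.

Lemma chain_of_nonstop x A : past A -> (forall z, ~ backtrack K x A z) ->
  forall n, exists ys, size ys = n /\ chain K x ys A.
Proof.
move=> pA ns n; elim: n x A pA ns => [|n IH] x A pA ns; first by exists [::].
have [nj|[s ls]] := last_jump_exists x pA.
  by exfalso; apply: (ns x); exact: backtrack_stop.
have [y jy _] := last_jump_edge ls.
have [||ys [sys cys]] := IH y `[0, s[%classic.
- by right; exists s => //; case: ls => _ [].
- by move=> z bz; apply: (ns z); exact: (backtrack_jump ls jy bz).
- by exists (y :: ys); split; [rewrite /= sys|exists s].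
Qed.

(** Nothing happens at x just after t, so that the algorithm may as well be
    started at a rational time. *)
Lemma nonstop_rational x t : 0 <= t -> (forall z, ~ backtrack K x `[0, t]%classic z) ->
  exists2 q : rat, 0 < q & forall z, ~ backtrack K x `[0, ratr q : R]%classic z.
Proof.
move=> t0 ns; have [d d0 H] := @siteN_right_constant _ _ _ regK x t t0.
have [q] := rat_in_itvoo (ltr_pwDr d0 (lexx t)).
rewrite in_itv/= => /andP[tq qd]; exists q.
  by rewrite -(ltr0q R); exact: le_lt_trans tq.
have nj s : t < s -> s <= ratr q -> ~ jump_time (site_path K x) s.
  move=> ts sq /(site_jump_timeP regK)[_ /(_ t t0 ts)].
  by rewrite (H s) ?(ltW ts)// ?ltnn//; exact: le_lt_trans qd.
move=> z bz; apply: (ns z); inversion bz as [x' A' nj' E1 E2 E3|x' y z' A' s ls jy bz' E1 E2 E3].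
  apply: backtrack_stop => s /=; rewrite in_itv/= => /andP[s0 st].
  by apply: nj'; rewrite /= in_itv/= s0 (le_trans st)// ltW.
apply: (backtrack_jump _ jy bz'); case: ls; rewrite /= in_itv/= => /andP[s0 sq] js Hs.
split=> //.
  rewrite /= in_itv/= s0/= leNgt; apply/negP => ts; exact: (nj s).
move=> r; rewrite /= in_itv/= => /andP[r0 rt]; apply: Hs.
by rewrite /= in_itv/= r0 (le_trans rt)// ltW.
Qed.

Lemma regular_Gamma_star :
  (forall x (q : rat), 0 < q -> exists z, backtrack K x `[0, ratr q : R]%classic z) ->
  Gamma_star K.
Proof.
move=> H; split; first exact: regular_Gamma.
move=> x t t0; have [z bz] : exists z, backtrack K x `[0, t]%classic z.
  apply: contrapT => /forallNP ns; have [q q0 nsq] := nonstop_rational t0 ns.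
  by have [z /nsq] := H x q q0.
rewrite /flow; case: xgetP => [_ _ [y -> _]|/(_ (Some z)) nz]; first by exists y.
by exfalso; apply: nz; exists z.
Qed.

Lemma flowE t x y : backtrack K x `[0, t]%classic y ->
  (forall z, backtrack K x `[0, t]%classic z -> z = y) -> flow K t x = Some y.
Proof.
move=> bx uni; rewrite /flow; case: xgetP => [_ _ [z -> /uni -> //]|/(_ (Some y)) nz].
by exfalso; apply: nz; exists y.
Qed.

Lemma flow_no_jump t x : (forall e, x \in val e -> K e t = 0%N) ->
  flow K t x = Some x.
Proof.
move=> H; have nj s : `[0, t]%classic s -> ~ jump_time (site_path K x) s.
  rewrite /= in_itv/= => /andP[s0 st] /(site_jump_timeP regK)/(siteN_jumpE regK).
  move=> [e xe [s0' /(_ 0 (lexx _) s0')]].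
  have := regular_nondecreasing regK e s0 st; rewrite H// leqn0 => /eqP->.
  by rewrite ltn0.
apply: flowE; first exact: backtrack_stop.
move=> z bz; inversion bz as [x' A' nj' E1 E2 E3|x' y z' A' s [As js _] jy bz' E1 E2 E3] => //.
by exfalso; exact: (nj s).
Qed.

(** The last jump at x is the only jump of e, after which the trajectory is at
    the other endpoint with no earlier jump to use. *)
Lemma flow_single_jump t x e : 0 <= t -> x \in val e -> K e t = 1%N ->
  (forall e', e' != e -> x \in val e' \/ other e x \in val e' -> K e' t = 0%N) ->
  flow K t x = Some (other e x).
Proof.
move=> t0 xe Ket H; set y := other e x.
have exy : edge_of x y = Some e := edge_of_other xe.
have only e' s : s <= t -> jump (K e') s -> x \in val e' \/ y \in val e' -> e' = e.
  move=> st [s0 /(_ 0 (lexx _) s0) +] xy; case: (eqVneq e' e) => // /H/(_ xy) e't.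
  have := regular_nondecreasing regK e' (ltW s0) st; rewrite e't leqn0 => /eqP->.
  by rewrite ltn0.
have once s s' : jump (K e) s -> jump (K e) s' -> s < s' -> s' <= t -> False.
  move=> [s0 js] [s'0 js'] ss' s't.
  have := js 0 (lexx _) s0; have := js' s (ltW s0) ss'.
  have := regular_nondecreasing regK e (ltW s'0) s't; rewrite Ket; lia.
have last A s : (A `<=` `[0, t]) -> last_jump_in K x A s -> s <= t /\ jump (K e) s.
  move=> At ls; have [As js Hs] := ls; have := At _ As.
  rewrite /= in_itv/= => /andP[_ st]; split=> //.
  have [y' _ [e' e'xy je']] := last_jump_edge ls.
  by rewrite -(only e' s st je')//; left; exact: edge_of_mem e'xy.
have nojump s : s <= t -> jump (K e) s ->
    forall u, `[0, s[%classic u -> ~ jump_time (site_path K y) u.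
  move=> st js u; rewrite /= in_itv/= => /andP[u0 us].
  move=> /(site_jump_timeP regK)/(siteN_jumpE regK)[e' ye' je'].
  have e'e : e' = e by apply: (only _ u) => //; [lra|right].
  by apply: (once u s) => //; rewrite -e'e.
have pt : past `[0, t]%classic by left; exists t.
apply: flowE.
  have [nj|[s ls]] := last_jump_exists x pt.
    have [//|s /andP[s0 st] js] := jump_exists (regular_nondecreasing regK e)
      (@right_constant_skorokhod _ (K e)) (lexx 0) t0.
      by rewrite (regular0 regK) Ket.
    exfalso; apply: (nj s); first by rewrite /= in_itv/= st ltW.
    by apply/(site_jump_timeP regK)/(siteN_jumpE regK); exists e.
  have [st js] := last _ s (@subset_refl _ _) ls.
  apply: (@backtrack_jump _ _ K x y y _ s ls).
    by apply/(pair_jump_timeP regK); exists e.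
  by apply: backtrack_stop; exact: nojump.
move=> z bz; inversion bz as [x' A' nj' E1 E2 E3|x' y' z' A' s ls jy bz' E1 E2 E3].
  have [//|s /andP[s0 st] js] := jump_exists (regular_nondecreasing regK e)
      (@right_constant_skorokhod _ (K e)) (lexx 0) t0.
    by rewrite (regular0 regK) Ket.
  exfalso; apply: (nj' s); first by rewrite /= in_itv/= st ltW.
  by rewrite -E3; apply/(site_jump_timeP regK)/(siteN_jumpE regK); exists e.
have [st js] := last _ s (@subset_refl _ _) ls.
have y'y : y' = y.
  have /(pair_jump_timeP regK)[e' e'xy je'] := jy.
  have e'e : e' = e by apply: (only _ s) => //; left; exact: edge_of_mem e'xy.
  by rewrite /y -e'e (edge_of_otherE e'xy).
rewrite y'y in bz'.
inversion bz' as [x2 A2 nj2 F1 F2 F3|x2 y2 z2 A2 s2 ls2 jy2 bz2 F1 F2 F3] => //.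
by exfalso; have [As2 js2 _] := ls2; exact: (nojump s st js s2).
Qed.

End backtracking.

(** * Measurability of the coordinates *)

Lemma inv_nat_lt (R : realType) (d : R) : 0 < d -> exists n : nat, n.+1%:R^-1 < d.
Proof.
move=> d0; exists (Num.bound `|d^-1|); rewrite invf_plt ?posrE//.
rewrite (le_lt_trans (ler_norm _))//.
by rewrite (lt_trans (archi_boundP _))// ltr_nat.
Qed.

Section skorokhod_measurability.
Context {R : realType}.

(** This condition survives small time changes, hence is open.  The bound d <= a
    keeps the neighbourhood in the positive times, the only ones that time
    changes control. *)
Definition constant_around (a b : R) (k : nat) : set (skorokhod R) :=
  [set x | exists2 d, 0 < d <= a & forall s, a - d < s -> s < b + d -> x s = k].

Lemma open_constant_around a b k : open (constant_around a b k).
Proof.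
move=> x [d /andP[d0 da] Hx]; exists (b + d), (d / 2); split; first lra.
move=> y [lambda _ Hl]; exists (d / 2); first by lra.
move=> s s1 s2; have [|+ ->] := Hl s; first by lra.
by rewrite ltr_norml => /andP[l1 l2]; apply: Hx; lra.
Qed.

(** Evaluation at t is not continuous, but by right-continuity it is determined
    by the values on intervals that shrink to t from the right. *)
Lemma measurable_eval (t : R) (k : nat) : 0 <= t ->
  measurable [set x : borel (skorokhod R) | x t = k].
Proof.
move=> t0.
have -> : [set x : borel (skorokhod R) | x t = k] = \bigcup_n \bigcap_m
    constant_around (t + (n + m).+1%:R^-1) (t + n.+1%:R^-1) k.
  apply/seteqP; split=> [x /= xt|x [n _ Hn]].
    have [d d0 Hd] := right_constant_skorokhod x t0.
    have [n nd] := inv_nat_lt d0.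
    exists n => // m _.
    have nm0 : 0 < (n + m).+1%:R^-1 :> R by rewrite invr_gt0.
    exists (Num.min (n + m).+1%:R^-1 (d - n.+1%:R^-1)).
      by rewrite lt_min nm0 subr_gt0 nd ge_min lerDr t0.
    move: nd nm0; set u := (n + m).+1%:R^-1; set v := n.+1%:R^-1 => nd nm0.
    set mn := Num.min _ _.
    have mn1 : mn <= u by rewrite ge_min lexx.
    have mn2 : mn <= d - v by rewrite ge_min lexx orbT.
    by move=> s s1 s2; rewrite -xt; apply: Hd; lra.
  have [d d0 Hd] := right_constant_skorokhod x t0.
  have [m md'] := inv_nat_lt d0.
  have md : (n + m).+1%:R^-1 < d.
    by apply: le_lt_trans md'; rewrite lef_pV2 ?posrE// ler_nat ltnS leq_addl.
  have nm0 : 0 < (n + m).+1%:R^-1 :> R by rewrite invr_gt0.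
  have nmn : (n + m).+1%:R^-1 <= n.+1%:R^-1 :> R.
    by rewrite lef_pV2 ?posrE// ler_nat ltnS leq_addr.
  have [e /andP[e0 ea] He] := Hn m I.
  move: He nmn md nm0 ea; set u := (n + m).+1%:R^-1; set v := n.+1%:R^-1.
  by move=> He nmn md nm0 ea; rewrite /= -(Hd (t + u)); [apply: He; lra|lra|lra].
apply: bigcup_measurable => n _; apply: bigcap_measurable; first by exists 0%N.
by move=> m _; apply: sub_sigma_algebra; exact: open_constant_around.
Qed.

Definition increment (x : skorokhod R) (a b : R) (A : set nat) : Prop :=
  exists2 k, A k & x b = (x a + k)%N.

Lemma measurable_increment a b (A : set nat) : 0 <= a -> 0 <= b ->
  measurable [set x : borel (skorokhod R) | increment x a b A].
Proof.
move=> a0 b0; have -> : [set x : borel (skorokhod R) | increment x a b A] =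
    \bigcup_(k in A) \bigcup_n ([set x : borel (skorokhod R) | x a = n] `&`
      [set x : borel (skorokhod R) | x b = (n + k)%N]).
  apply/seteqP; split=> [x [k Ak xk]|x [k Ak [n _ [/= <-]]]]; last by exists k.
  by exists k => //; exists (x a).
apply: bigcup_measurable => k _; apply: bigcup_measurable => n _.
by apply: measurableI; exact: measurable_eval.
Qed.

Lemma measurable_increments (n : nat) (t : nat -> R) (A : nat -> set nat) :
  (forall i, 0 <= t i) ->
  measurable [set x : borel (skorokhod R) |
    forall i, (i < n)%N -> increment x (t i) (t i.+1) (A i)].
Proof.
move=> t0; have -> : [set x : borel (skorokhod R) |
    forall i, (i < n)%N -> increment x (t i) (t i.+1) (A i)] =
  \bigcap_(i in `I_n) [set x : borel (skorokhod R) | increment x (t i) (t i.+1) (A i)].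
  by apply/seteqP; split=> x /= H i; exact: H.
by apply: bigcap_measurableType => i _; exact: measurable_increment.
Qed.

Lemma measurable_coordinate {S : choiceType} (e : edge S) :
  measurable_fun setT (@coordinate R S e).
Proof.
apply: (@measurability _ _ (borel (path_space R S)) (borel (skorokhod R)) _ _
  (@open (skorokhod R))) => // _ [U oU <-].
rewrite setTI; apply: sub_sigma_algebra.
have pc : continuous (proj e : path_space R S -> skorokhod R).
  by move=> K; exact: proj_continuous.
exact: (continuousP _).1 pc U oU.
Qed.

End skorokhod_measurability.

(** * Independence of the increments *)

Section poisson_increments.
Context {R : realType}.

Section one_process.
Context d (Omega : measurableType d) (P : probability Omega R) (r : R)
  (N : Omega -> skorokhod R).
Hypotheses (NP : poisson_process P r N)
  (mN : measurable_fun setT (N : Omega -> borel (skorokhod R))).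

Let measurable_evt (n : nat) (t : nat -> R) (A : nat -> set nat) :
  (forall i, 0 <= t i) ->
  measurable [set w | forall i, (i < n)%N -> increment (N w) (t i) (t i.+1) (A i)].
Proof.
by move=> t0; have := mN measurableT (measurable_increments n A t0); rewrite setTI.
Qed.

(** Independence is known for prescribed values of the increments; arbitrary
    sets of values are reached one increment at a time by countable
    additivity. *)
Lemma poisson_increments (n : nat) (t : nat -> R) (A : nat -> set nat) :
  0 <= t 0%N -> (forall i, t i <= t i.+1) ->
  P [set w | forall i, (i < n)%N -> increment (N w) (t i) (t i.+1) (A i)] =
  (\prod_(i < n) fine (poisson_prob (r * (t i.+1 - t i)) 0 (A i)))%:E.
Proof.
move=> t00 tS; have t0 i : 0 <= t i.
  by elim: i => // i /le_trans; apply.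
pose mu i := poisson_prob (r * (t i.+1 - t i)) 0.
(* The increments before p range over A, the others have prescribed values. *)
pose B p (k : nat -> nat) i := if (i < p)%N then A i else [set k i].
suff H p : (p <= n)%N -> forall k,
    P [set w | forall i, (i < n)%N -> increment (N w) (t i) (t i.+1) (B p k i)] =
    (\prod_(i < n) fine (mu i (B p k i)))%:E.
  have := H n (leqnn n) (fun=> 0%N).
  under [X in (X%:E)]eq_bigr do rewrite /B ltn_ord.
  move=> <-; congr (P _); apply/seteqP; split=> w /= Hw i i_n;
    by have := Hw i i_n; rewrite /B i_n.
elim: p => [_ k|p IH pn k].
  have [_ N2 N3] := NP; rewrite [LHS](_ : _ =
      P [set w | forall i, (i < n)%N -> N w (t i.+1) = (N w (t i) + k i)%N]).
    rewrite N3//; congr (_%:E); apply: eq_bigr => i _.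
    by rewrite N2.
  congr (P _); apply/seteqP; split=> w /= Hw i i_n.
    by have [_ ->] := Hw i i_n.
  by exists (k i); [|exact: Hw].
pose upd j i := if i == p then j else k i.
have Bp j i : B p (upd j) i = if i == p then [set j] else B p.+1 k i.
  rewrite /B /upd; case: (eqVneq i p) => [->|ip]; first by rewrite ltnn.
  by rewrite ltnS [(i <= p)%N]leq_eqVlt (negbTE ip).
have Bp1 : B p.+1 k p = A p by rewrite /B ltnSn.
have -> : [set w | forall i, (i < n)%N -> increment (N w) (t i) (t i.+1) (B p.+1 k i)] =
    \bigcup_(j in A p) [set w | forall i, (i < n)%N ->
      increment (N w) (t i) (t i.+1) (B p (upd j) i)].
  apply/seteqP; split=> [w Hw|w [j Aj Hw] i i_n].
    have := Hw p pn; rewrite Bp1 => -[j Aj Nj]; exists j => // i i_n.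
    rewrite Bp; case: (eqVneq i p) => [->|_]; last exact: Hw.
    by exists j.
  have := Hw i i_n; rewrite Bp; case: (eqVneq i p) => [->|_//].
  by rewrite Bp1 => -[_ -> Nj]; exists j.
pose C := \prod_(i < n | i != Ordinal pn) fine (mu i (B p.+1 k i)).
have C0 : 0 <= C by apply: prodr_ge0 => l _; rewrite fine_ge0// measure_ge0.
have PB j : P [set w | forall i, (i < n)%N ->
      increment (N w) (t i) (t i.+1) (B p (upd j) i)] = (C%:E * mu p [set j])%E.
  rewrite IH//; last exact: ltnW.
  rewrite (bigD1 (Ordinal pn))//= mulrC EFinM; congr (_ * _)%E.
    congr (_%:E); apply: eq_bigr => i ip; congr (fine (mu i _)).
    by rewrite Bp ifN_eq.
  by rewrite Bp eqxx fineK// fin_num_measure.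
rewrite measure_bigcup; last 2 first.
- by move=> j _; exact: measurable_evt.
- apply/trivIsetP => i j _ _ ij; rewrite -subset0 => w [/= /(_ p pn) + /(_ p pn)].
  rewrite !Bp eqxx => -[_ -> Ni] [_ -> Nj]; move: Nj; rewrite Ni => /eqP.
  by rewrite eqn_add2l (negbTE ij).
rewrite (eq_eseriesr (fun j _ => PB j)).
rewrite nneseriesZl; last by move=> j _; exact: measure_ge0.
rewrite (_ : (\sum_(i <oo | i \in A p) mu p [set i])%E = mu p (A p)); last first.
  rewrite -measure_bigcup//; first by rewrite bigcup_imset1 image_id.
  by apply/trivIsetP => i j _ _ ij; rewrite -subset0 => w /= [-> /eqP]; rewrite (negbTE ij).
rewrite [in RHS](bigD1 (Ordinal pn))//= mulrC EFinM; congr (_ * _)%E.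
by rewrite Bp1 fineK// fin_num_measure.
Qed.

End one_process.

Lemma poisson_prob0 (r : R) : 0 <= r -> poisson_prob r 0 [set 0%N] = (expR (- r))%:E.
Proof.
rewrite le_eqVlt => /orP[/eqP<-|r0]; rewrite /poisson_prob.
  by rewrite ltxx diracE mem_set// oppr0 expR0.
by rewrite r0 esum_set1/poisson_pmf r0 ?expr0 ?mul1r ?fact0 ?invr1 ?mul1r// lee_fin expR_ge0.
Qed.

Lemma poisson_prob_gt0 (r : R) : 0 <= r ->
  poisson_prob r 0 [set k | (0 < k)%N] = (1 - expR (- r))%:E.
Proof.
move=> r0; rewrite EFinB -poisson_prob0// -(probability_setC (poisson_prob r 0))//.
by congr (poisson_prob _ _ _); apply/seteqP; split=> -[|k]//=.
Qed.

Lemma poisson_prob_gt1 (r : R) : 0 <= r ->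
  (poisson_prob r 0 [set k | (1 < k)%N] <= (r ^+ 2)%:E)%E.
Proof.
rewrite le_eqVlt => /orP[/eqP<-|r0].
  rewrite /poisson_prob ltxx diracE memNset ?lee_fin ?sqr_ge0//.
have -> : [set k | (1 < k)%N] = [set k | (0 < k)%N] `\` [set 1%N].
  by apply/seteqP; split=> [[|[|k]]//= _|[|[|k]] [//= _ k1]].
rewrite measureD//; last by rewrite -ge0_fin_numE// fin_num_measure.
rewrite (_ : _ `&` _ = [set 1%N]); last by apply/seteqP; split=> [k []//|k /= ->].
change (poisson_prob r 0 [set k | (0 < k)%N] - poisson_prob r 0 [set 1%N] <= (r ^+ 2)%:E)%E.
rewrite poisson_prob_gt0 ?(ltW r0)// /poisson_prob r0 esum_set1; last first.
  by rewrite lee_fin poisson_pmf_ge0.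
have f1 : 1%N`!%:R = 1 :> R by [].
rewrite /poisson_pmf r0 expr1 f1 invr1 mulr1 -EFinB lee_fin.
have := expR_ge1Dx (- r); have := expR_ge0 (- r); nra.
Qed.

End poisson_increments.

(** * Countable families *)

Section countable_families.
Context {R : realType}.

Lemma esum_tail (I : choiceType) (D : set I) (a : I -> \bar R) (eps : R) :
  (forall i, D i -> 0 <= a i)%E -> (\esum_(i in D) a i < +oo)%E -> 0 < eps ->
  exists F : {fset I}, (forall i, i \in F -> D i) /\
    (\esum_(i in D `\` [set` F]) a i <= eps%:E)%E.
Proof.
move=> a0 aoo eps0.
have afin : (\esum_(i in D) a i)%E \is a fin_num by rewrite ge0_fin_numE// esum_ge0.
have [_ [X [finX XD] <-] Xe] := ub_ereal_sup_adherent eps0 afin.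
have {}Xe : (\esum_(i in D) a i - eps%:E < \sum_(i \in X) a i)%E := Xe.
exists (fset_set X); split=> [i|]; first by rewrite in_fset_set// inE => /XD.
rewrite fset_setK//.
have := esumID X D a a0; rewrite (setIidr XD) (@esum_fset _ _ X)//; last first.
  by move=> i; rewrite inE => Xi; exact/a0/XD.
rewrite setDE => HD.
have t0 : (0 <= \esum_(i in D `&` ~` X) a i)%E by apply: esum_ge0 => i [Di _]; exact: a0.
have s0 : (0 <= \sum_(i \in X) a i)%E by apply: fsume_ge0 => i Xi; exact/a0/XD.
move: afin Xe; rewrite HD; set u := (\sum_(i \in X) a i)%E in s0 *.
set v := (esum _ _) in t0 *.
case: u s0 => [u||] // _; case: v t0 => [v||]// _ _.
by rewrite -EFinN -!EFinD lte_fin lee_fin; lra.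
Qed.

Lemma esum_finset (I : choiceType) (F : {fset I}) (a : I -> \bar R) :
  (forall i, 0 <= a i)%E -> (\esum_(i in [set` F]) a i = \sum_(i <- F) a i)%E.
Proof.
move=> a0; rewrite esum_fset//.
by rewrite fsbig_finite//= set_fsetK.
Qed.

Lemma sum_le_esum (I : choiceType) (D : set I) (a : I -> \bar R) (F : {fset I}) :
  (forall i, D i -> 0 <= a i)%E -> (forall i, i \in F -> D i) ->
  (\sum_(i <- F) a i <= \esum_(i in D) a i)%E.
Proof.
move=> a0 FD; apply: esum_ge; exists [set` F]; last by rewrite fsbig_finite//= set_fsetK.
by split=> // i /FD.
Qed.

Lemma le_esumZl (I : choiceType) (D : set I) (a : I -> \bar R) (r : R) :
  (forall i, D i -> 0 <= a i)%E -> 0 <= r ->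
  (\esum_(i in D) (r%:E * a i) <= r%:E * \esum_(i in D) a i)%E.
Proof.
move=> a0 r0; apply: ge_ereal_sup => _ [X [finX XD] <-].
rewrite fsbig_finite//= big_seq.
rewrite -ge0_sume_distrr; last by move=> i; rewrite in_fset_set// inE => /XD; exact: a0.
rewrite -big_seq lee_wpmul2l// -fsbig_finite//.
by apply: ereal_sup_ubound; exists X.
Qed.

Context d (T : measurableType d) (mu : {measure set T -> \bar R}).

Lemma negligible_eps (A : set T) :
  (forall eps : R, 0 < eps -> exists B, [/\ measurable B, A `<=` B & (mu B <= eps%:E)%E]) ->
  mu.-negligible A.
Proof.
move=> H.
have /choice[B HB] n : exists B, [/\ measurable B, A `<=` B & (mu B <= (n.+1%:R^-1)%:E)%E].
  by apply: H; rewrite invr_gt0.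
exists (\bigcap_n B n); have mcap : measurable (\bigcap_n B n).
  by apply: bigcapT_measurable => n; have [] := HB n.
split=> //; last by move=> w Aw n _; have [_ AB _] := HB n; exact: AB.
apply/eqP; rewrite eq_le measure_ge0 andbT; apply/lee_addgt0Pr => e e0; rewrite add0e.
have [n ne] := inv_nat_lt e0.
have [mB _ Be] := HB n.
apply: (@le_trans _ _ (mu (B n))).
  by apply: le_measure; rewrite ?inE//; exact: bigcap_inf.
by apply: (le_trans Be); rewrite lee_fin ltW.
Qed.

Let enumerated (I : countType) (B : I -> set T) (n : nat) : set T :=
  if choice.unpickle n is Some i then B i else set0.

Let existsE (I : countType) (D : set I) (B : I -> set T) :
  [set w | exists2 i, D i & B i w] =
  \bigcup_(n in choice.pickle @` D) enumerated B n.
Proof.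
apply/seteqP; split=> w /=.
  move=> [i Di Bi]; exists (choice.pickle i); first by exists i.
  by rewrite /enumerated choice.pickleK.
by move=> [_ [i Di <-]]; rewrite /enumerated choice.pickleK; exists i.
Qed.

Let measurable_enumerated (I : countType) (B : I -> set T) n :
  (forall i, measurable (B i)) -> measurable (enumerated B n).
Proof. by move=> mB; rewrite /enumerated; case: choice.unpickle. Qed.

Lemma measurable_exists (I : countType) (D : set I) (B : I -> set T) :
  (forall i, measurable (B i)) -> measurable [set w | exists2 i, D i & B i w].
Proof.
move=> mB; rewrite existsE.
by apply: bigcup_measurable => n _; exact: measurable_enumerated.
Qed.

(** Events about backtracking trajectories are only estimated from outside,
    hence through the outer measure. *)
Lemma outer_measure_exists_esum (I : countType) (D : set I) (B : I -> set T) :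
  ((mu^*)%mu [set w | exists2 i, D i & B i w] <= \esum_(i in D) (mu^*)%mu (B i))%E.
Proof.
pose J : set nat := choice.pickle @` D; pose G := enumerated B; rewrite existsE -/J -/G.
apply: (@le_trans _ _ (\esum_(n in J) (mu^*)%mu (G n))%E); last first.
  rewrite /J esum_image; last by move=> i j _ _ /(pcan_inj choice.pickleK).
  by apply: le_esum => i _; rewrite /G /enumerated choice.pickleK.
rewrite bigcup_mkcond esum_mkcond -nneseries_esumT; last first.
  by move=> n; case: ifP => // _; exact: mu_ext_ge0.
apply: le_trans (mu_ext_sigma_subadditive _ _) _; first exact: measure_ge0.
by apply: lee_nneseries => [n _ _|n _]; [exact: mu_ext_ge0|case: ifP; rewrite ?mu_ext0].
Qed.

Lemma measure_exists_esum (I : countType) (D : set I) (B : I -> set T) :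
  (forall i, measurable (B i)) ->
  (mu [set w | exists2 i, D i & B i w] <= \esum_(i in D) mu (B i))%E.
Proof.
move=> mB; rewrite -measurable_mu_extE; last exact: measurable_exists.
apply: (le_trans (outer_measure_exists_esum _ _)).
by apply: le_esum => i _; rewrite measurable_mu_extE.
Qed.

Lemma outer_measure_le (A B : set T) : measurable B -> A `<=` B ->
  ((mu^*)%mu A <= mu B)%E.
Proof. by move=> mB AB; rewrite -measurable_mu_extE//; exact: le_mu_ext. Qed.

Lemma negligible_mu_ext (A : set T) :
  (forall eps : R, 0 < eps -> ((mu^*)%mu A <= eps%:E)%E) -> mu.-negligible A.
Proof.
move=> H; apply: negligible_eps => eps eps0.
have fA : (mu^*)%mu A \is a fin_num.
  by rewrite ge0_fin_numE ?mu_ext_ge0//; exact: le_lt_trans (H 1 ltr01) (ltry _).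
have e2 : 0 < eps / 2 by rewrite divr_gt0.
have [_ [B [mB AB] <-] lt] := lb_ereal_inf_adherent e2 fA.
have mU : measurable (\bigcup_n B n) by exact: bigcup_measurable.
exists (\bigcup_n B n); split=> //.
apply: (@le_trans _ _ (\sum_(k <oo) mu (B k))%E).
  exact: measure_sigma_subadditive.
apply: (le_trans (ltW lt)); rewrite [leRHS](_ : _ = (eps / 2)%:E + (eps / 2)%:E)%E.
  by rewrite leeD2r//; exact: H.
by rewrite -EFinD -splitr.
Qed.

Lemma measurable_exists_seq (I : eqType) (s : seq I) (B : I -> set T) :
  (forall i, measurable (B i)) -> measurable [set w | exists2 i, i \in s & B i w].
Proof.
move=> mB; elim: s => [|i l IH].
  by rewrite (_ : [set _ | _] = set0)//; apply/seteqP; split=> // w [].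
rewrite (_ : [set _ | _] = B i `|` [set w | exists2 i, i \in l & B i w]).
  exact: measurableU.
apply/seteqP; split=> w /=.
  by move=> [j]; rewrite inE => /orP[/eqP->|jl] Bj; [left|right; exists j].
case=> [Bi|[j jl Bj]]; first by exists i => //; rewrite mem_head.
by exists j => //; rewrite inE jl orbT.
Qed.

Lemma measure_exists_seq (I : eqType) (s : seq I) (B : I -> set T) :
  (forall i, measurable (B i)) ->
  (mu [set w | exists2 i, i \in s & B i w] <= \sum_(i <- s) mu (B i))%E.
Proof.
move=> mB; have mE l := measurable_exists_seq l mB.
elim: s => [|i l IH].
  rewrite big_nil (_ : [set _ | _] = set0) ?measure0//.
  by apply/seteqP; split=> // w [].
rewrite big_cons (_ : [set _ | _] = B i `|` [set w | exists2 i, i \in l & B i w]).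
  by apply: (le_trans (measureU2 _ _ _)) => //; exact: leeD.
apply/seteqP; split=> w /=.
  by move=> [j]; rewrite inE => /orP[/eqP->|jl] Bj; [left|right; exists j].
case=> [Bi|[j jl Bj]]; first by exists i => //; rewrite mem_head.
by exists j => //; rewrite inE jl orbT.
Qed.

Lemma negligible_exists (I : countType) (B : I -> set T) :
  (forall i, mu.-negligible (B i)) -> mu.-negligible [set w | exists i, B i w].
Proof.
move=> nB; have : mu.-negligible (\bigcup_n enumerated B n).
  apply: negligible_bigcup => n; rewrite /enumerated; case: choice.unpickle => //.
  exact: negligible_set0.
apply: negligibleS => w [i Bi]; exists (choice.pickle i) => //.
by rewrite /enumerated choice.pickleK.
Qed.

End countable_families.

(** * Independent Poisson processes *)

Lemma negligible_setC d (T : measurableType d) (R : realType)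
    (P : probability T R) (A : set T) :
  measurable A -> P A = 1%E -> P.-negligible (~` A).
Proof.
move=> mA PA; exists (~` A); split=> //; first exact: measurableC.
by rewrite probability_setC// PA subee.
Qed.

Section poisson_family.
Context {R : realType} {S : countType} (c : edge S -> R).
Hypothesis c_ge0 : forall e, 0 <= c e.
Variable P : probability (borel (path_space R S)) R.
Hypothesis P_poisson : poisson_law c P.
Implicit Types (e : edge S) (a b t : R).

Definition edge_increment e a b (A : set nat) : set (borel (path_space R S)) :=
  [set K | increment (K e) a b A].

Lemma measurable_edge_increment e a b A : 0 <= a -> 0 <= b ->
  measurable (edge_increment e a b A).
Proof.
move=> a0 b0.
have := measurable_coordinate (R := R) e measurableT (measurable_increment A a0 b0).
by rewrite setTI.
Qed.

Lemma edge_increments_prob (F : {fset edge S}) (n : nat) (t : nat -> R)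
    (A : nat -> edge S -> set nat) :
  0 <= t 0%N -> (forall i, t i <= t i.+1) ->
  P [set K | forall e, e \in F -> forall i, (i < n)%N ->
       edge_increment e (t i) (t i.+1) (A i e) K] =
  (\prod_(i < n) \prod_(e <- F)
     fine (poisson_prob (c e * (t i.+1 - t i)) 0 (A i e)))%:E.
Proof.
move=> t00 tS; have t0 i : 0 <= t i.
  by elim: i => // i /le_trans; apply.
have [NP ind] := P_poisson.
pose B e := [set x : borel (skorokhod R) |
  forall i, (i < n)%N -> increment x (t i) (t i.+1) (A i e)].
have mB e : measurable (B e) by exact: measurable_increments.
rewrite [LHS](_ : _ = P (\bigcap_(e in [set` F]) coordinate e @^-1` B e)); last first.
  by congr (P _); apply/seteqP; split.
rewrite (ind F B)// exchange_big/=; congr (_%:E); apply: eq_bigr => e _.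
have := poisson_increments (NP e) (@measurable_coordinate R S e) n (A^~ e) t00 tS.
by move=> /(congr1 fine).
Qed.

Lemma edge_increment_prob e a b A : 0 <= a -> a <= b ->
  P (edge_increment e a b A) = poisson_prob (c e * (b - a)) 0 A.
Proof.
move=> a0 ab; have [NP _] := P_poisson.
pose t i : R := if i is 0%N then a else b.
have tS i : t i <= t i.+1 by case: i.
have := poisson_increments (NP e) (@measurable_coordinate R S e) 1 (fun=> A)
  (a0 : 0 <= t 0%N) tS.
rewrite big_ord1 fineK ?fin_num_measure// => <-; congr (P _).
apply/seteqP; split=> K /= => [H [|i]//|/(_ 0%N isT)//].
Qed.

Lemma edge_increment_prob2 e e' a b A B : e != e' -> 0 <= a -> a <= b ->
  P (edge_increment e a b A `&` edge_increment e' a b B) =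
  (poisson_prob (c e * (b - a)) 0 A * poisson_prob (c e' * (b - a)) 0 B)%E.
Proof.
move=> ee' a0 ab; pose t i : R := if i is 0%N then a else b.
have tS i : t i <= t i.+1 by case: i.
have := edge_increments_prob [fset e; e']%fset 1
  (fun _ f => if f == e then A else B) (a0 : 0 <= t 0%N) tS.
rewrite big_ord1 big_fsetU1 ?inE//= big_seq_fset1 eqxx eq_sym (negbTE ee').
rewrite EFinM !fineK ?fin_num_measure// => <-; congr (P _).
apply/seteqP; split=> K /=.
  move=> [HA HB] f; rewrite in_fset2 => /orP[]/eqP-> [|//] _; rewrite ?eqxx//.
  by rewrite eq_sym (negbTE ee').
move=> H; split.
  by have := H e; rewrite in_fset2 eqxx => /(_ isT 0%N isT).
by have := H e'; rewrite in_fset2 eqxx orbT eq_sym (negbTE ee') => /(_ isT 0%N isT).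
Qed.

Definition jumps e a b := edge_increment e a b [set k | (0 < k)%N].

Lemma jumpsE e a b (K : path_space R S) : jumps e a b K <-> (K e a < K e b)%N.
Proof.
split=> [[k /= k0 ->]|ab]; first by rewrite -addn1 leq_add2l.
exists (K e b - K e a)%N; first by rewrite /= subn_gt0.
by rewrite subnKC// ltnW.
Qed.

Lemma cM_ge0 e a b : a <= b -> 0 <= c e * (b - a).
Proof. by move=> ab; rewrite mulr_ge0// subr_ge0. Qed.

Lemma jumps_prob e a b : 0 <= a -> a <= b ->
  P (jumps e a b) = (1 - expR (- (c e * (b - a))))%:E.
Proof. by move=> a0 ab; rewrite edge_increment_prob// poisson_prob_gt0// cM_ge0. Qed.

Lemma jumps_prob_le e a b : 0 <= a -> a <= b ->
  (P (jumps e a b) <= (c e * (b - a))%:E)%E.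
Proof.
move=> a0 ab; rewrite jumps_prob// lee_fin.
by have := expR_ge1Dx (- (c e * (b - a))); lra.
Qed.

Definition both_jump e e' a b : set (borel (path_space R S)) :=
  if e == e' then set0 else jumps e a b `&` jumps e' a b.

Lemma measurable_both_jump e e' a b : 0 <= a -> 0 <= b ->
  measurable (both_jump e e' a b).
Proof.
move=> a0 b0; rewrite /both_jump; case: ifP => // _.
by apply: measurableI; exact: measurable_edge_increment.
Qed.

Lemma both_jump_prob e e' a b : 0 <= a -> a <= b ->
  (P (both_jump e e' a b) <= (c e * c e' * (b - a) ^+ 2)%:E)%E.
Proof.
move=> a0 ab; rewrite /both_jump; case: eqP => [_|/eqP ee'].
  by rewrite measure0 lee_fin mulr_ge0 ?sqr_ge0// mulr_ge0.
rewrite edge_increment_prob2// !poisson_prob_gt0 ?cM_ge0// -EFinM lee_fin.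
have -> : c e * c e' * (b - a) ^+ 2 = (c e * (b - a)) * (c e' * (b - a)) by ring.
have h f : 0 <= 1 - expR (- (c f * (b - a))) <= c f * (b - a).
  rewrite subr_ge0 expR_le1 oppr_le0 cM_ge0//=.
  by have := expR_ge1Dx (- (c f * (b - a))); lra.
have /andP[h1 h2] := h e; have /andP[h3 h4] := h e'.
exact: ler_pM.
Qed.

Definition two_jumps e e' a b : set (borel (path_space R S)) :=
  edge_increment e a b [set k | (1 < k)%N] `|` both_jump e e' a b.

Lemma measurable_two_jumps e e' a b : 0 <= a -> 0 <= b ->
  measurable (two_jumps e e' a b).
Proof.
move=> a0 b0; apply: measurableU; first exact: measurable_edge_increment.
exact: measurable_both_jump.
Qed.

Lemma two_jumps_prob e e' a b : 0 <= a -> a <= b ->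
  (P (two_jumps e e' a b) <= ((c e ^+ 2 + c e * c e') * (b - a) ^+ 2)%:E)%E.
Proof.
move=> a0 ab; have b0 := le_trans a0 ab.
apply: (le_trans (measureU2 _ _ _)).
- exact: measurable_edge_increment.
- exact: measurable_both_jump.
rewrite mulrDl EFinD leeD//; last exact: both_jump_prob.
rewrite -exprMn; have := poisson_prob_gt1 (cM_ge0 e ab).
by rewrite -edge_increment_prob.
Qed.

Lemma no_two_jumps e e' a b (K : path_space R S) :
  (K e a <= K e b)%N -> (K e' a <= K e' b)%N ->
  ~ two_jumps e e' a b K -> no_double_jump K e e' a b.
Proof.
move=> m m' H; split.
  rewrite leqNgt; apply/negP => Hlt; apply: H; left.
  by exists (K e b - K e a)%N; [rewrite /= ltn_subRL addn1|rewrite subnKC].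
move=> ee'; have [->|/eqP ne] := eqVneq (K e a) (K e b); first by left.
have [->|/eqP ne'] := eqVneq (K e' a) (K e' b); first by right.
exfalso; apply: H; right; rewrite /both_jump (negbTE ee').
by split; apply/jumpsE; rewrite ltn_neqAle ?m ?m' andbT; exact/eqP.
Qed.

Hypothesis c_site : forall x : S, (\esum_(e in [set e : edge S | x \in val e]) (c e)%:E < +oo)%E.

Definition nondecreasing_family : set (borel (path_space R S)) :=
  [set K | forall e, K e 0 = 0%N /\ nondecreasing_path (K e)].

(** By right-continuity, monotonicity at rational times is enough. *)
Lemma nondecreasing_family_ae : P.-negligible (~` nondecreasing_family).
Proof.
have [NP _] := P_poisson.
have m0 e (n : nat) (t : R) : 0 <= t -> measurable [set K : borel (path_space R S) | K e t = n].
  move=> t0; have := measurable_coordinate (R := R) e measurableT (measurable_eval n t0).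
  by rewrite setTI.
have n0 e : P.-negligible (~` [set K : borel (path_space R S) | K e 0 = 0%N]).
  by apply: negligible_setC; [exact: m0|have [H _ _] := NP e; exact: H].
have nq (i : edge S * rat * rat) : P.-negligible
    (~` [set K : borel (path_space R S) | 0 <= ratr i.1.2 :> R -> ratr i.1.2 <= ratr i.2 :> R ->
      (K i.1.1 (ratr i.1.2) <= K i.1.1 (ratr i.2))%N]).
  case: i => -[e p] q /=; have [p0|p0] := boolP (0 <= ratr p :> R); last first.
    rewrite (_ : ~` _ = set0); first exact: negligible_set0.
    by apply/seteqP; split=> // K H; exfalso; apply: H.
  have [pq|pq] := boolP (ratr p <= ratr q :> R); last first.
    rewrite (_ : ~` _ = set0); first exact: negligible_set0.
    by apply/seteqP; split=> // K H; exfalso; apply: H.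
  rewrite (_ : ~` _ = ~` edge_increment e (ratr p) (ratr q) setT); last first.
    congr (~` _); apply/seteqP; split=> K /=.
      by move=> /(_ isT isT) H; exists (K e (ratr q) - K e (ratr p))%N => //; rewrite subnKC.
    by move=> [k _ ->] _ _; exact: leq_addr.
  apply: negligible_setC; first exact: measurable_edge_increment (le_trans p0 pq).
  by rewrite edge_increment_prob// probability_setT.
have := negligibleU (negligible_exists n0) (negligible_exists nq).
apply: negligibleS => K HK; apply: contrapT => H; apply: HK => e.
have K0 : K e 0 = 0%N by apply: contrapT => H0; apply: H; left; exists e.
have Kq (p q : rat) : 0 <= ratr p :> R -> ratr p <= ratr q :> R ->
    (K e (ratr p) <= K e (ratr q))%N.
  move=> p0 pq; apply/negPn/negP => Hpq; apply: H; right; exists (e, p, q) => /=.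
  by move=> /(_ p0 pq); exact/negP.
split=> // s t s0; rewrite le_eqVlt => /orP[/eqP->//|st].
have t0 := le_lt_trans s0 st.
have [d d0 Hd] := right_constant_skorokhod (K e) s0.
have [d' d'0 Hd'] := right_constant_skorokhod (K e) (ltW t0).
have sdt : s < Num.min (s + d) t by rewrite lt_min ltrDl d0.
have td' : t < t + d' by rewrite ltrDl.
have [p] := rat_in_itvoo sdt; have [q] := rat_in_itvoo td'.
rewrite !in_itv/= lt_min => /andP[tq qd] /andP[sp /andP[pd pt]].
rewrite -(Hd (ratr p)) ?(ltW sp)// -(Hd' (ratr q)) ?(ltW tq)//.
apply: Kq; first exact: le_trans (ltW sp).
by rewrite ltW// (lt_trans pt).
Qed.

(** Finitely many edges at x jump before T because the rates at x are summable
    (Borel-Cantelli).  Double and simultaneous jumps are excluded because m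
    cells of length T/m contain one with probability at most m * O(1/m^2). *)
Lemma regular_ae : P.-negligible (~` [set K | regular K]).
Proof.
have fin (i : S * nat) : P.-negligible (nondecreasing_family `\` [set K |
    finite_set [set e : edge S | i.1 \in val e /\ K e i.2%:R <> 0%N]]).
  case: i => x T; apply: negligible_eps => eps eps0 /=.
  pose D := [set e : edge S | x \in val e].
  have [||F [FD HF]] := @esum_tail R _ D (fun e => (c e * T%:R)%:E) eps _ _ eps0.
  - by move=> e _; rewrite lee_fin mulr_ge0.
  - rewrite (_ : (fun e => (c e * T%:R)%:E) = (fun e => (T%:R%:E * (c e)%:E)%E)); last first.
      by apply/funext => e; rewrite mulrC EFinM.
    apply: (le_lt_trans (le_esumZl _ _)) => //; first by move=> e _; rewrite lee_fin.
    have /fineK <- : (\esum_(e in D) (c e)%:E)%E \is a fin_num.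
      by rewrite ge0_fin_numE ?c_site// esum_ge0// => e _; rewrite lee_fin.
    by rewrite -EFinM ltry.
  exists [set K | exists2 e, (D `\` [set` F]) e & jumps e 0 T%:R K]; split.
  - by apply: measurable_exists => e; exact: measurable_edge_increment.
  - move=> K [HK HK']; apply: contrapT => nj; apply: HK'.
    apply: (sub_finite_set _ (finite_fset F)) => e /= [xe Ke].
    apply/negPn/negP => eF; apply: nj; exists e; first by split=> //; exact/negP.
    by apply/jumpsE; have [-> _] := HK e; rewrite lt0n; exact/eqP.
  - apply: (le_trans (measure_exists_esum _ _ _)).
      by move=> e; exact: measurable_edge_increment.
    apply: le_trans HF; apply: le_esum => e _.
    by rewrite (le_trans (jumps_prob_le _ _ _))// subr0.
have simple (i : edge S * edge S * nat) : P.-negligible (nondecreasing_family `\` [set K |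
    exists2 m : nat, (0 < m)%N & forall j, (j < m)%N ->
      no_double_jump K i.1.1 i.1.2 (grid i.2%:R m j) (grid i.2%:R m j.+1)]).
  case: i => -[e e'] T; apply: negligible_eps => eps eps0 /=.
  pose C := (c e ^+ 2 + c e * c e') * T%:R ^+ 2.
  have C0 : 0 <= C by rewrite mulr_ge0 ?sqr_ge0// addr_ge0 ?sqr_ge0// mulr_ge0.
  pose m := (Num.bound (C / eps)).+1.
  have mC : C / m%:R <= eps.
    rewrite ler_pdivrMr// mulrC -ler_pdivrMr// ltW//.
    by rewrite (lt_le_trans (archi_boundP _)) ?divr_ge0 ?(ltW eps0)// ler_nat.
  have g0 j : 0 <= grid T%:R m j :> R by rewrite grid_ge0.
  have gS j : grid T%:R m j <= grid T%:R m j.+1 :> R by rewrite grid_le.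
  pose B j := two_jumps e e' (grid T%:R m j) (grid T%:R m j.+1).
  have mB j : measurable (B j) by exact: measurable_two_jumps.
  exists [set K | exists2 j, j \in iota 0 m & B j K]; split.
  - exact: measurable_exists.
  - move=> K [HK HK']; apply: contrapT => nj; apply: HK'; exists m => // j jm.
    apply: no_two_jumps; [exact: (HK e).2|exact: (HK e').2|].
    by move=> Bj; apply: nj; exists j => //; rewrite mem_iota.
  - apply: (le_trans (measure_exists_seq _ _ mB)).
    apply: (@le_trans _ _ (\sum_(j <- iota 0 m) (C / m%:R ^+ 2)%:E)%E).
      apply: lee_sum => j _; apply: (le_trans (two_jumps_prob _ _ _ _)) => //.
      by rewrite gridS expr_div_n mulrA.
    rewrite sumEFin lee_fin big_const_seq count_predT size_iota iter_addr_0.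
    have mN0 : m%:R != 0 :> R by rewrite pnatr_eq0.
    have aux (C' u : R) : u != 0 -> C' / u ^+ 2 * u = C' / u.
      by move=> u0; rewrite expr2 invfM -!mulrA mulVf// mulr1.
    by rewrite -[leLHS]mulr_natr aux.
have := negligibleU nondecreasing_family_ae
  (negligibleU (negligible_exists fin) (negligible_exists simple)).
apply: negligibleS => K HK; apply: contrapT => H; apply: HK.
have KI : nondecreasing_family K by apply: contrapT => HI; apply: H; left.
split=> [e|e|x T|e e' T]; [exact: (KI e).1|exact: (KI e).2| |].
- by apply: contrapT => Hf; apply: H; right; left; exists (x, T).
- by apply: contrapT => Hs; apply: H; right; right; exists (e, e', T).
Qed.

End poisson_family.

(** * Discretized holding times of the random walk *)

Lemma measure_exists_disjoint d (T : measurableType d) (R : realType)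
    (mu : {measure set T -> \bar R}) (I : eqType) (s : seq I) (B : I -> set T) :
  (forall i, measurable (B i)) -> uniq s ->
  (forall i j, i \in s -> j \in s -> i != j -> B i `&` B j = set0) ->
  mu [set w | exists2 i, i \in s & B i w] = (\sum_(i <- s) mu (B i))%E.
Proof.
move=> mB; elim: s => [_ _|i l IH /= /andP[il ul] dB].
  rewrite big_nil (_ : [set _ | _] = set0) ?measure0//.
  by apply/seteqP; split=> // w [].
have dl j k : j \in l -> k \in l -> j != k -> B j `&` B k = set0.
  by move=> jl kl; apply: dB; rewrite inE ?jl ?kl orbT.
rewrite big_cons -(IH ul dl) (_ : [set _ | _] = B i `|` [set w | exists2 i, i \in l & B i w]).
  rewrite measureU//.
    exact: measurable_exists_seq.
  apply/seteqP; split=> // w [Bi [j jl Bj]].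
  have ij : i != j by apply: contraNneq il => ->.
  by rewrite -(dB i j _ _ ij) ?mem_head// inE jl orbT.
apply/seteqP; split=> w /=.
  by move=> [j]; rewrite inE => /orP[/eqP->|jl] Bj; [left|right; exists j].
case=> [Bi|[j jl Bj]]; first by exists i => //; rewrite mem_head.
by exists j => //; rewrite inE jl orbT.
Qed.

Fixpoint nat_words (m n : nat) : seq (seq nat) :=
  if n is n'.+1 then [seq a :: l | a <- iota 0 m, l <- nat_words m n'] else [:: [::]].

Lemma nat_words_uniq m n : uniq (nat_words m n).
Proof.
elim: n => //= n IH; apply: allpairs_uniq => //; first exact: iota_uniq.
by move=> [a l] [b k] _ _ /= [-> ->].
Qed.

Lemma mem_nat_words m n l :
  (l \in nat_words m n) = (size l == n) && all (fun a => a < m)%N l.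
Proof.
elim: n l => [|n IH] l; first by case: l.
case: l => [|a l] /=; first by apply/negbTE/negP => /allpairsP[[a l] [_ _]].
rewrite eqSS [RHS]andbCA andbC -IH andbC; apply/allpairsP/andP => /=.
  by move=> [[b k] [/= bm kn [-> ->]]]; move: bm; rewrite mem_iota.
by move=> [am ln]; exists (a, l); rewrite mem_iota.
Qed.

Section discretized_walk.
Context {R : realType} {S : choiceType} (c : edge S -> R).
Context d (Omega : measurableType d) (Q : probability Omega R)
  (x : S) (Y : nat -> Omega -> S) (tau : nat -> Omega -> \bar R).
Hypothesis walk : random_walk c Q x Y tau.

Let rate z := fine (site_rate c z).

Let walk_event (n p : nat) (y : nat -> S) (t : nat -> R) (h : R) : set Omega :=
  [set w | (forall i, (i <= n)%N -> Y i w = y i /\ ((t i)%:E < tau i w)%E) /\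
           (forall i, (i < p)%N -> (tau i w <= (t i + h)%:E)%E)].

Let measurable_tau_gt i (a : R) : measurable [set w | (a%:E < tau i w)%E].
Proof.
have [_ mt _ _] := walk.
have := mt i measurableT _ (emeasurable_itv (Interval (BRight a%:E) +oo%O)).
rewrite setTI; congr measurable; apply/seteqP; split=> w /=.
  by rewrite in_itv/= andbT.
by rewrite in_itv/= andbT.
Qed.

Let measurable_walk_event n p y t h : measurable (walk_event n p y t h).
Proof.
have [mY _ _ _] := walk.
apply: measurableI.
  rewrite (_ : (fun _ => _) = \bigcap_(i in [set i | (i <= n)%N])
      (Y i @^-1` [set y i] `&` [set w | ((t i)%:E < tau i w)%E])).
    by apply: bigcap_measurableType => i _; apply: measurableI.
  by apply/seteqP; split=> w H i /= /H.
rewrite (_ : (fun _ => _) = \bigcap_(i in [set i | (i < p)%N])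
    ~` [set w | ((t i + h)%:E < tau i w)%E]).
  by apply: bigcap_measurableType => i _; apply: measurableC.
apply/seteqP; split=> w H i /= /H; first by rewrite leNgt => /negP.
by move=> /negP; rewrite -leNgt.
Qed.

(** An upper bound on a holding time is the complement of a lower bound, so the
    survival probabilities that define the walk give the law of the cells as
    differences. *)
Let walk_event_prob n p y t h : (p <= n)%N -> (forall i, 0 <= t i) -> 0 <= h ->
  Q (walk_event n p y t h) =
  ((y 0%N == x)%:R * \prod_(i < n) jump_proba c (y i) (y i.+1) *
   \prod_(i < n.+1) (if (i < p)%N
      then expR (- (rate (y i) * t i)) - expR (- (rate (y i) * (t i + h)))
      else expR (- (rate (y i) * t i))))%:E.
Proof.
move=> + + h0; elim: p t => [|p IH] t pn t0.
  have [_ _ _ W] := walk; rewrite -W//; congr (Q _).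
  by apply/seteqP; split=> w; [case|split].
pose t' i := if i == p then t p + h else t i.
have t'0 i : 0 <= t' i by rewrite /t'; case: ifP => // _; rewrite addr_ge0.
have -> : walk_event n p.+1 y t h = walk_event n p y t h `\` walk_event n p y t' h.
  apply/seteqP; split=> [w [H1 H2]|w [[H1 H2] H3]].
    split; first by split=> // i ip; apply: H2; exact: ltnW.
    move=> [H3 _]; have [_] := H3 p (ltnW pn); rewrite /t' eqxx ltNge.
    by rewrite H2.
  split=> // i; rewrite ltnS leq_eqVlt => /orP[/eqP->|]; last exact: H2.
  rewrite leNgt; apply/negP => Hp; apply: H3; split=> [j jn|j jp].
    have [Yj tj] := H1 j jn; split=> //; rewrite /t'.
    by case: eqVneq => // ->.
  by rewrite /t' ltn_eqF// H2.
have sub : walk_event n p y t h `&` walk_event n p y t' h = walk_event n p y t' h.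
  apply/seteqP; split=> [w []//|w [H1 H2]]; split=> //; split=> i ii; last first.
    by have := H2 i ii; rewrite /t' ltn_eqF.
  have [-> ti] := H1 i ii; split=> //; apply: le_lt_trans ti.
  by rewrite lee_fin /t'; case: eqVneq => // ->; rewrite lerDl.
rewrite measureD//; last by rewrite -ge0_fin_numE// fin_num_measure.
rewrite [X in (_ - X)%E](_ : _ = Q (walk_event n p y t' h)); last by rewrite sub.
rewrite [X in (X - _)%E](_ : _ = Q (walk_event n p y t h))//.
rewrite !IH//; [|exact: ltnW|exact: ltnW].
rewrite -EFinB -mulrBr; congr (_ * _)%:E.
have pn1 : (p < n.+1)%N by exact: ltnW.
have big (G : nat -> R) : \prod_(i < n.+1) G i =
    G p * \prod_(i < n.+1 | i != Ordinal pn1) G i.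
  by rewrite (bigD1 (Ordinal pn1)).
pose G (u : nat -> R) r i := if (i < r)%N
  then expR (- (rate (y i) * u i)) - expR (- (rate (y i) * (u i + h)))
  else expR (- (rate (y i) * u i)).
change (\prod_(i < n.+1) G t p i - \prod_(i < n.+1) G t' p i =
  \prod_(i < n.+1) G t p.+1 i).
rewrite (big (G t p)) (big (G t' p)) (big (G t p.+1)) {1 3 5}/G ltnn ltnSn.
set A := \prod_(i < n.+1 | _) _; set B := \prod_(i < n.+1 | _) _; set C := \prod_(i < n.+1 | _) _.
have BA : B = A.
  apply: eq_bigr => i ip; rewrite /G /t' (_ : (nat_of_ord i == p) = false)//.
  exact/negbTE.
have CA : C = A.
  apply: eq_bigr => i ip; rewrite /G ltnS [(i <= p)%N]leq_eqVlt.
  by rewrite (_ : (nat_of_ord i == p) = false)//; apply/negbTE.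
by rewrite BA CA -mulrBl /t' eqxx.
Qed.

(** Probability that the walk follows the path z :: ys, the i-th holding time
    lying in the i-th entry of l, as a cell number for cells of length h. *)
Fixpoint walk_weight (h : R) (z : S) (ys : seq S) (l : seq nat) : R :=
  match ys, l with
  | y :: ys', a :: l' =>
      jump_proba c z y *
      (expR (- (rate z * (a%:R * h))) * (1 - expR (- (rate z * h)))) *
      walk_weight h y ys' l'
  | _, _ => 1
  end.

Lemma walk_weight_prod (x0 : S) h z ys l : size l = size ys ->
  walk_weight h z ys l = \prod_(i < size ys)
   (jump_proba c (nth x0 (z :: ys) i) (nth x0 (z :: ys) i.+1) *
    (expR (- (rate (nth x0 (z :: ys) i) * ((nth 0%N l i)%:R * h))) -
     expR (- (rate (nth x0 (z :: ys) i) * ((nth 0%N l i)%:R * h + h))))).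
Proof.
elim: ys z l => [|y ys IH] z [|a l]//=; first by rewrite big_ord0.
move=> [sl]; rewrite big_ord_recl/= (IH y l sl); congr (_ * _ * _).
by rewrite mulrBr mulr1 -expRD -opprD mulrDr.
Qed.

(** The walk makes at least n jumps by time q. *)
Definition fast (n : nat) (q : R) : set Omega :=
  [set w | (\sum_(i < n) tau i w <= q%:E)%E].

Lemma measurable_fast n q : measurable (fast n q).
Proof.
have [_ mt _ _] := walk.
have ms : measurable_fun setT (fun w => (\sum_(i < n) tau i w)%E).
  by apply: emeasurable_sum.
have := ms measurableT _ (emeasurable_itv (Interval -oo%O (BRight q%:E))).
rewrite setTI; congr measurable; apply/seteqP; split=> w /=; by rewrite in_itv.
Qed.

Definition walk_follows (ys : seq S) (q : R) : set Omega :=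
  [set w | (forall i, (i <= size ys)%N -> Y i w = nth x (x :: ys) i) /\
           fast (size ys) q w].

Lemma measurable_walk_follows ys q : measurable (walk_follows ys q).
Proof.
have [mY _ _ _] := walk; apply: measurableI; last exact: measurable_fast.
rewrite (_ : (fun _ => _) = \bigcap_(i in [set i | (i <= size ys)%N])
    (Y i @^-1` [set nth x (x :: ys) i])).
  by apply: bigcap_measurableType => i _.
by apply/seteqP; split=> w H i /= /H.
Qed.

(** Distinct sequences of cells give disjoint events, and the sequence l forces
    the last jump to occur before (steps l) * h, which is at most q. *)
Lemma walk_weight_sum (ys : seq S) (m : nat) (h q : R) : 0 < h -> m%:R * h <= q ->
  ((\sum_(l <- nat_words m (size ys) | (sumn [seq a.+1 | a <- l] <= m)%N)
      walk_weight h x ys l)%:E <= Q (walk_follows ys q))%E.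
Proof.
move=> h0 mhq; set n := size ys; pose y i := nth x (x :: ys) i.
(* The walk leaves the n first sites of the path in the prescribed cells; of
   the holding time at the last one it is only required that it be positive. *)
pose t (l : seq nat) i : R := if (i < n)%N then (nth 0%N l i)%:R * h else 0.
have t0 l i : 0 <= t l i.
  by rewrite /t; case: ifP => // _; rewrite mulr_ge0// ltW.
pose B l := walk_event n n y (t l) h.
have QB l : size l = n -> (walk_weight h x ys l)%:E = Q (B l).
  move=> sl; rewrite /B walk_event_prob ?(ltW h0)//; congr (_%:E).
  rewrite (walk_weight_prod x)// big_split/= eqxx mul1r; congr (_ * _).
  rewrite big_ord_recr/= /t !ltnn mulr0 oppr0 expR0 mulr1.
  by apply: eq_bigr => i _; have ii : (i < n)%N := ltn_ord i; rewrite ii.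
rewrite -big_filter; set s := [seq l <- _ | _].
have ss l : l \in s -> size l = n /\ (sumn [seq a.+1 | a <- l] <= m)%N.
  by rewrite mem_filter mem_nat_words => /andP[-> /andP[/eqP]].
rewrite -sumEFin big_seq (eq_bigr (fun l => Q (B l))); last first.
  by move=> l /ss[sl _]; exact: QB.
rewrite -big_seq -measure_exists_disjoint; first last.
- move=> l l' /ss[sl _] /ss[sl' _] ll'; rewrite -subset0 => w [[G H] [G' H']].
  have [k kn ne] : exists2 k, (k < n)%N & nth 0%N l k != nth 0%N l' k.
    apply: contrapT => nk; move/eqP: ll'; apply.
    apply: (@eq_from_nth _ 0%N); first by rewrite sl.
    by move=> k kl; apply/eqP/negPn/negP => ne; apply: nk; exists k; rewrite -?sl.
  have sep (l1 l2 : seq nat) : (nth 0%N l1 k < nth 0%N l2 k)%N ->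
      (tau k w <= (t l1 k + h)%:E)%E -> ((t l2 k)%:E < tau k w)%E -> False.
    move=> lt le gt; have := lt_le_trans gt le; rewrite lte_fin /t kn.
    rewrite -[X in _ + X]mul1r -mulrDl ltr_pM2r// natr1 ltr_nat ltnS leqNgt lt.
    by [].
  have [_ Gk] := G k (ltnW kn); have [_ Gk'] := G' k (ltnW kn).
  by case: ltngtP ne => // lt _;
    [exact: sep lt (H k kn) Gk'|exact: sep lt (H' k kn) Gk].
- by rewrite filter_uniq// nat_words_uniq.
- by move=> l; exact: measurable_walk_event.
apply: le_measure; rewrite ?inE.
- by apply: measurable_exists_seq => l; exact: measurable_walk_event.
- exact: measurable_walk_follows.
move=> w [l /ss[sl lm] [G H]]; split; first by move=> i /G[].
have le i : (i < n)%N -> (tau i w <= (((nth 0%N l i).+1)%:R * h)%:E)%E.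
  by move=> ii; have := H i ii; rewrite /t ii -natr1 mulrDl mul1r.
apply: (@le_trans _ _ (\sum_(i < size ys) (((nth 0%N l i).+1)%:R * h)%:E)%E).
  by apply: lee_sum => i _; exact: le.
rewrite sumEFin lee_fin -mulr_suml -natr_sum.
rewrite (_ : (\sum_(i < size ys) (nth 0%N l i).+1)%N = sumn [seq a.+1 | a <- l]).
  by apply: le_trans mhq; rewrite ler_pM2r// ler_nat.
rewrite sumnE big_map (big_nth 0%N) big_mkord sl; exact: eq_bigr.
Qed.

End discretized_walk.

(** * Discretization of the backtracking algorithm *)

(** The number of cells used when the waiting times, in cells, are l: each of
    them is followed by the cell of a jump. *)
Definition steps (l : seq nat) : nat := sumn [seq a.+1 | a <- l].

Lemma steps_small m l : (steps l <= m)%N -> all (fun a => a < m)%N l.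
Proof.
elim: l => //= a l IH; rewrite /steps/= -/(steps l) => H.
apply/andP; split; first by apply: leq_trans H; rewrite addSn ltnS leq_addr.
by apply: IH; apply: leq_trans H; exact: leq_addl.
Qed.

Section backtracking_words.
Context {R : realType} {S : countType}.
Implicit Types (x y : S) (e : edge S) (ys : seq S) (l : seq nat).

(** A label constrains the increment of each edge over one cell of the grid. *)
Definition label := edge S -> set nat.

Definition stay x : label := fun e => if x \in val e then [set 0%N] else setT.

Definition leave x y : label :=
  fun e => if edge_of x y == Some e then [set k | (0 < k)%N] else setT.

(** Words are read forward in time whereas backtracking goes backward: the first
    step of the path is at the end of the word. *)
Fixpoint word x ys l : seq label :=
  match ys, l with
  | y :: ys', a :: l' => word y ys' l' ++ leave x y :: nseq a (stay x)
  | _, _ => [::]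
  end.

Lemma size_word x ys l : size l = size ys -> size (word x ys l) = steps l.
Proof.
elim: ys x l => [|y ys IH] x [|a l]//= [sl].
by rewrite size_cat/= size_nseq IH// addnC.
Qed.

Variables (F : {fset edge S}) (q : R) (m : nat).
Hypotheses (q_ge0 : 0 <= q) (m_gt0 : (0 < m)%N).

Local Notation g := (grid q m).

(** The first letter of w concerns the cell number b. *)
Definition word_event (b : nat) (w : seq label) : set (borel (path_space R S)) :=
  [set K | forall k, (k < size w)%N -> forall e, e \in F ->
     edge_increment e (g (b + k)) (g (b + k).+1) (nth (fun=> setT) w k e) K].

Lemma word_event_cat b (w1 w2 : seq label) K :
  word_event b w1 K -> word_event (b + size w1) w2 K -> word_event b (w1 ++ w2) K.
Proof.
move=> H1 H2 k; rewrite size_cat => kw e eF; rewrite nth_cat.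
case: ltnP => k1; first exact: H1.
have := H2 (k - size w1)%N; rewrite ltn_subLR// => /(_ kw e eF).
by rewrite -addnA subnKC.
Qed.

Fixpoint path_in x ys : Prop :=
  if ys is y :: ys' then
    (exists2 e, edge_of x y = Some e & e \in F) /\ path_in y ys'
  else True.

Definition simple_cells (K : path_space R S) : Prop :=
  forall j, (j < m)%N -> forall e e', e \in F -> e' \in F ->
    no_double_jump K e e' (g j) (g j.+1).

(** The invariant of the induction is that A contains all positive times up to
    g p and that the edges of F do not jump in A after g p.  It is preserved
    because the cell i of a jump contains no other jump of F, so that p becomes
    i in the next step. *)
Lemma chain_word (K : path_space R S) x ys (A : set R) p :
  regular K -> simple_cells K -> path_in x ys -> chain K x ys A -> (p <= m)%N ->
  (forall s, 0 < s -> s <= g p -> A s) ->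
  (forall s e, e \in F -> A s -> jump (K e) s -> s <= g p) ->
  exists l, [/\ size l = size ys, (steps l <= p)%N &
                word_event (p - steps l) (word x ys l) K].
Proof.
move=> regK simK; elim: ys x A p => [|y ys IH] x A p; first by exists [::].
move=> /= [[e0 e0xy e0F] pys] [s [ls js cys]] pm Ap jA.
have [As jxs Hs] := ls.
have je0 : jump (K e0) s.
  by have /(pair_jump_timeP regK)[e] := js; rewrite e0xy => -[<-].
have s0 := je0.1; have sp := jA s e0 e0F As je0.
(* The jump leaving x is in the cell i; the cells between i and p are spent
   at x. *)
have [i ip /andP[is_ si]] := grid_cell q_ge0 s0 sp.
have im : (i < m)%N := leq_trans ip pm.
have gi0 : 0 <= g i by exact: grid_ge0.
have mono e := regular_nondecreasing regK e.
have jumpi : (K e0 (g i) < K e0 s)%N by exact: je0.2.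
have [l [sl li Hl]] : exists l, [/\ size l = size ys, (steps l <= i)%N &
    word_event (i - steps l) (word y ys l) K].
  apply: (IH y `[0, s[%classic i) => //; first exact: ltnW.
    by move=> u u0 ui; rewrite /= in_itv/= ltW//= (le_lt_trans ui).
  move=> u e eF; rewrite /= in_itv/= => /andP[u0 us] ju.
  rewrite leNgt; apply/negP => iu.
  have K1 : (K e (g i) < K e u)%N by exact: ju.2.
  have K2 : (K e u <= K e (g i.+1))%N by apply: mono => //; lra.
  have K3 : (K e0 s <= K e0 (g i.+1))%N by apply: mono => //; lra.
  have [Hd He] := simK i im e e0 eF e0F.
  have [ee0|/He[] HK] := eqVneq e e0; last 2 first.
  - by move: K1; rewrite HK ltnNge K2.
  - by move: jumpi; rewrite HK ltnNge K3.
  have : (K e0 u < K e0 s)%N by exact: je0.2.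
  rewrite ee0 in Hd K1 => us'.
  by have := leq_trans (leq_ltn_trans K1 us') (leq_trans K3 Hd); rewrite ltnn.
exists ((p - i.+1)%N :: l); split; rewrite /= ?sl//.
  by rewrite /steps/= -/(steps l); lia.
have -> : (p - steps ((p - i.+1)%N :: l) = i - steps l)%N.
  by rewrite /steps/= -/(steps l); lia.
apply: word_event_cat => //; rewrite size_word// subnK//.
case=> [_ e eF|k]; rewrite /= ?addn0.
  rewrite /leave; case: eqP => [|_].
    rewrite e0xy => -[<-]; apply/jumpsE; apply: (leq_trans jumpi).
    by apply: mono => //; lra.
  exists (K e (g i.+1) - K e (g i))%N => //; rewrite subnKC//.
  by apply: mono => //; apply: grid_le.
rewrite size_nseq ltnS => kpi e eF; rewrite nth_nseq kpi.
have ik0 : 0 <= g (i + k.+1) by exact: grid_ge0.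
have ikS : g (i + k.+1) <= g (i + k.+1).+1 by exact: grid_le.
rewrite /stay; case: ifPn => [xe|_]; last first.
  exists (K e (g (i + k.+1).+1) - K e (g (i + k.+1)))%N => //.
  by rewrite subnKC//; exact: mono.
exists 0%N => //; rewrite addn0; apply/eqP; rewrite eqn_leq (mono e _ _ ik0 ikS) andbT.
rewrite leqNgt; apply/negP => lt.
have [u /andP[ku uk] ju] := jump_exists (mono e) (@right_constant_skorokhod _ (K e)) ik0 ikS lt.
have su : s < u.
  by apply: (le_lt_trans si); apply: le_lt_trans ku; apply: grid_le => //;
    rewrite addnS ltnS leq_addr.
have up : u <= g p by apply: (le_trans uk); apply: grid_le => //;
    rewrite addnS -addSn -ltn_subRL.
have : u <= s.
  apply: (Hs u (Ap u ju.1 up)).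
  by apply/(site_jump_timeP regK)/(siteN_jumpE regK); exists e.
by rewrite leNgt su.
Qed.

Lemma chain_word_start (K : path_space R S) x ys :
  regular K -> simple_cells K -> path_in x ys -> chain K x ys `[0, q]%classic ->
  exists l, [/\ size l = size ys, (steps l <= m)%N &
                word_event (m - steps l) (word x ys l) K].
Proof.
move=> regK simK pys cK; apply: (chain_word regK simK pys cK) => //.
  by move=> s s0; rewrite grid_last// => sq; rewrite /= in_itv/= sq ltW.
by move=> s e _; rewrite /= in_itv/= grid_last// => /andP[].
Qed.

Variable c : edge S -> R.
Hypothesis c_ge0 : forall e, 0 <= c e.
Variable P : probability (borel (path_space R S)) R.
Hypothesis P_poisson : poisson_law c P.

Let h := q / m%:R.

Let h_ge0 : 0 <= h. Proof. by rewrite divr_ge0. Qed.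

Definition label_weight (a : label) : R :=
  \prod_(e <- F) fine (poisson_prob (c e * h) 0 (a e)).

Lemma measurable_word_event b w : measurable (word_event b w).
Proof.
rewrite (_ : word_event b w = \bigcap_(k in `I_(size w)) \bigcap_(e in [set` F])
  edge_increment e (g (b + k)) (g (b + k).+1) (nth (fun=> setT) w k e)).
  apply: bigcap_measurableType => k _; apply: fin_bigcap_measurable => // e _.
  by apply: measurable_edge_increment; exact: grid_ge0.
by apply/seteqP; split=> K H k /= kw e /= eF; exact: H.
Qed.

Lemma word_event_prob b (w : seq label) :
  P (word_event b w) = (\prod_(a <- w) label_weight a)%:E.
Proof.
rewrite (_ : word_event b w = [set K | forall e, e \in F -> forall k, (k < size w)%N ->
    edge_increment e (g (b + k)) (g (b + k.+1)) (nth (fun=> setT) w k e) K]).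
  rewrite (edge_increments_prob P_poisson F (size w) (t := fun k => g (b + k))); last 2 first.
  - exact: grid_ge0.
  - by move=> k; apply: grid_le => //; rewrite addnS.
  congr (_%:E); rewrite (big_nth (fun=> setT)) big_mkord; apply: eq_bigr => k _.
  by apply: eq_bigr => e _; rewrite addnS gridS.
apply/seteqP; split=> K H.
  by move=> e eF k kw; rewrite addnS; exact: H.
by move=> k kw e eF; rewrite -addnS; exact: H.
Qed.

Definition rate_in x : R := \sum_(e <- F | x \in val e) c e.

Lemma label_weight_stay x : label_weight (stay x) = expR (- (rate_in x * h)).
Proof.
rewrite /label_weight (bigID (fun e : edge S => x \in val e))/= [X in _ * X]big1 ?mulr1.
  rewrite mulr_suml -sumrN expR_sum; apply: eq_bigr => e xe.
  by rewrite /stay xe poisson_prob0//= mulr_ge0.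
by move=> e /negbTE xe; rewrite /stay xe probability_setT.
Qed.

Lemma label_weight_leave x y e : edge_of x y = Some e -> e \in F ->
  label_weight (leave x y) = 1 - expR (- (conductance c x y * h)).
Proof.
move=> exy eF; rewrite /label_weight (big_fsetD1 e)//= [X in _ * X]big_seq big1 ?mulr1.
  by rewrite /leave /conductance exy eqxx poisson_prob_gt0// mulr_ge0.
move=> e'; rewrite in_fsetD1 => /andP[e'e _].
rewrite /leave exy (_ : (Some e == Some e') = false) ?probability_setT//.
by apply/eqP => -[ee']; rewrite ee' eqxx in e'e.
Qed.

Definition word_weight x ys l : R := \prod_(a <- word x ys l) label_weight a.

Lemma word_weight_cons x y ys a l e : edge_of x y = Some e -> e \in F ->
  word_weight x (y :: ys) (a :: l) =
  (1 - expR (- (conductance c x y * h))) * expR (- (rate_in x * (a%:R * h))) *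
  word_weight y ys l.
Proof.
move=> exy eF; rewrite /word_weight/= big_cat big_cons/= (label_weight_leave exy eF).
rewrite mulrC; congr (_ * _ * _).
rewrite big_nseq label_weight_stay iter_mulr_1 -expRM_natl; congr expR.
by rewrite mulrN mulrCA mulrA.
Qed.

End backtracking_words.

(** * Almost sure termination of the backtracking algorithm *)

Section step_comparison.
Context {R : realType} {S : countType} (c : edge S -> R).
Hypothesis c_ge0 : forall e, 0 <= c e.
Hypothesis c_rate : forall x, (site_rate c x < +oo)%E.

Lemma site_rate_edges x :
  site_rate c x = (\esum_(e in [set e : edge S | x \in val e]) (c e)%:E)%E.
Proof.
rewrite -(esum_site (fun e => (c e)%:E) x) /site_rate esum_mkcond [RHS]esum_mkcond.
apply: eq_esum => y _; rewrite in_setT /conductance.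
case: ifPn => [_|]; first by case: edge_of.
rewrite notin_setE/= => /contrapT ->.
by rewrite edge_of_refl.
Qed.

Local Notation rate x := (fine (site_rate c x)).

Lemma site_rate_fin x : site_rate c x = (rate x)%:E.
Proof.
rewrite fineK// ge0_fin_numE// site_rate_edges esum_ge0// => e _.
by rewrite lee_fin.
Qed.

Lemma rate_ge0 x : 0 <= rate x.
Proof.
by rewrite -lee_fin -site_rate_fin site_rate_edges esum_ge0// => e _; rewrite lee_fin.
Qed.

Lemma conductance_ge0 x y : 0 <= conductance c x y.
Proof. by rewrite /conductance; case: edge_of. Qed.

Lemma conductance_le_rate x y : conductance c x y <= rate x.
Proof.
rewrite -lee_fin -site_rate_fin; apply: esum_ge; exists [set y] => //.
by rewrite fsbig_set1.
Qed.

Lemma jump_proba_ge0 x y : 0 <= jump_proba c x y.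
Proof.
rewrite /jump_proba; case: ifP => // _; rewrite divr_ge0 ?rate_ge0//.
exact: conductance_ge0.
Qed.

Lemma rate_approx x (eps : R) : 0 < eps -> exists F0 : {fset edge S},
  forall F : {fset edge S}, (F0 `<=` F)%fset -> rate x - rate_in F c x <= eps.
Proof.
move=> eps0; pose D := [set e : edge S | x \in val e].
have cD e : D e -> (0 <= (c e)%:E)%E by rewrite lee_fin.
have [|F0 [F0D tail]] := esum_tail cD _ eps0.
  by rewrite -site_rate_edges.
exists F0 => F F0F; rewrite lerBlDr -lee_fin -site_rate_fin site_rate_edges.
rewrite (esumID [set` F0])// addeC EFinD leeD//.
rewrite (setIidr F0D) /rate_in big_fset_condE/=.
set G := [fset _ | _ in _ & _]%fset.
rewrite -sumEFin -(esum_finset G) ?(esum_finset F0)//.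
apply: (@sum_le_esum _ _ [set` G] (fun e => (c e)%:E)) => e; first by rewrite lee_fin.
by move=> eF0; rewrite /= !inE/= (fsubsetP F0F)//=; exact: F0D.
Qed.

(** One step of backtracking against one step of the walk.  Replacing rate_in by
    rate costs the factor expR (delta * q), over a waiting time of at most q;
    replacing the probability that one edge jumps in a cell by its share of the
    probability that the walk jumps costs the factor expR delta. *)
Lemma step_le (F : {fset edge S}) x y (h q delta : R) (a : nat) :
  0 <= h -> a%:R * h <= q -> 0 <= delta -> rate x - rate_in F c x <= delta ->
  rate x * h <= delta ->
  (1 - expR (- (conductance c x y * h))) * expR (- (rate_in F c x * (a%:R * h))) <=
  expR (delta * (q + 1)) * (jump_proba c x y *
    (expR (- (rate x * (a%:R * h))) * (1 - expR (- (rate x * h))))).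
Proof.
move=> h0 ahq d0 dF dh; have r0 := rate_ge0 x; have c0 := conductance_ge0 x y.
have ah0 : 0 <= a%:R * h by rewrite mulr_ge0.
have rh0 : 0 <= rate x * h by rewrite mulr_ge0.
have rh1 : 0 <= 1 - expR (- (rate x * h)) by rewrite subr_ge0 expR_le1 oppr_le0.
have [rx|rx] := eqVneq (rate x) 0.
  have -> : conductance c x y = 0.
    by apply/eqP; rewrite eq_le c0 andbT -rx conductance_le_rate.
  rewrite mul0r oppr0 expR0 subrr mul0r mulr_ge0 ?expR_ge0// mulr_ge0 ?jump_proba_ge0//.
  by rewrite mulr_ge0 ?expR_ge0.
rewrite /jump_proba (negbTE rx).
have e1 : expR (- (rate_in F c x * (a%:R * h))) <=
    expR (delta * q) * expR (- (rate x * (a%:R * h))).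
  rewrite -expRD ler_expR.
  have : (rate x - rate_in F c x) * (a%:R * h) <= delta * q.
    by apply: le_trans (ler_wpM2l d0 ahq); rewrite ler_wpM2r.
  by rewrite mulrBl; lra.
have e2 : 1 - expR (- (conductance c x y * h)) <= expR delta *
    (conductance c x y / rate x * (1 - expR (- (rate x * h)))).
  have u1 : conductance c x y * h <= conductance c x y / rate x *
      ((1 + rate x * h) * (1 - expR (- (rate x * h)))).
    have -> : conductance c x y * h = conductance c x y / rate x * (rate x * h).
      by rewrite mulrA mulfVK.
    rewrite ler_wpM2l ?divr_ge0//.
    move: rh0 {dh rh1}; move: (rate x * h) => u u0.
    have := expR_ge1Dx u; have : expR u * expR (- u) = 1.
      by rewrite -expRD subrr expR0.
    have := expR_ge0 (- u); nra.
  have u2 : 1 - expR (- (conductance c x y * h)) <= conductance c x y * h.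
    by have := expR_ge1Dx (- (conductance c x y * h)); lra.
  apply: (le_trans u2); apply: (le_trans u1).
  rewrite [leRHS]mulrCA ler_wpM2l ?divr_ge0// ler_wpM2r//.
  by apply: le_trans (expR_ge1Dx delta); rewrite lerD2l.
have -> : expR (delta * (q + 1)) * (conductance c x y / rate x *
    (expR (- (rate x * (a%:R * h))) * (1 - expR (- (rate x * h))))) =
  (expR delta * (conductance c x y / rate x * (1 - expR (- (rate x * h))))) *
  (expR (delta * q) * expR (- (rate x * (a%:R * h)))).
  by rewrite mulrDr mulr1 expRD; ring.
apply: ler_pM; rewrite ?expR_ge0//.
by rewrite subr_ge0 expR_le1 oppr_le0 mulr_ge0.
Qed.

Lemma word_weight_le (F : {fset edge S}) (q : R) (m : nat) (delta : R) x ys l :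
  0 <= q -> (0 < m)%N -> 0 <= delta ->
  (forall z, z \in x :: ys -> rate z - rate_in F c z <= delta) ->
  (forall z, z \in x :: ys -> rate z * (q / m%:R) <= delta) ->
  path_in F x ys -> size l = size ys -> (steps l <= m)%N ->
  word_weight F q m c x ys l <=
  expR (delta * (q + 1)) ^+ size ys * walk_weight c (q / m%:R) x ys l.
Proof.
move=> q0 m0 d0; have h0 : 0 <= q / m%:R by rewrite divr_ge0.
have ww z zs k : 0 <= walk_weight c (q / m%:R) z zs k.
  elim: zs z k => [|y zs IH] z [|a k]//=; rewrite mulr_ge0// mulr_ge0 ?jump_proba_ge0//.
  by rewrite mulr_ge0 ?expR_ge0// subr_ge0 expR_le1 oppr_le0 mulr_ge0 ?rate_ge0.
elim: ys x l => [|y ys IH] x [|a l]//=; first by rewrite /word_weight big_nil mulr1.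
move=> Hd Hh [[e exy eF] pys] [sl]; rewrite /steps/= -/(steps l) => sm.
rewrite (word_weight_cons m q0 c_ge0 ys a l exy eF) exprS -mulrA.
rewrite [leRHS](_ : _ = (expR (delta * (q + 1)) * (jump_proba c x y *
    (expR (- (rate x * (a%:R * (q / m%:R)))) * (1 - expR (- (rate x * (q / m%:R))))))) *
  (expR (delta * (q + 1)) ^+ size ys * walk_weight c (q / m%:R) y ys l)); last by ring.
rewrite mulrA; have amq : a%:R * (q / m%:R) <= q.
  rewrite mulrA ler_pdivrMr ?ltr0n// mulrC ler_wpM2l// ler_nat.
  by apply: leq_trans sm; exact: (leq_trans (leqnSn a) (leq_addr _ _)).
apply: ler_pM.
- rewrite mulr_ge0 ?expR_ge0// subr_ge0 expR_le1 oppr_le0 mulr_ge0//.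
  exact: conductance_ge0.
- apply: prodr_ge0 => b _; apply: prodr_ge0 => e' _.
  by rewrite fine_ge0// measure_ge0.
- by apply: step_le => //; [apply: Hd|apply: Hh]; rewrite mem_head.
- apply: IH => //; last by apply: leq_trans sm; exact: leq_addl.
    by move=> z zy; apply: Hd; rewrite inE zy orbT.
  by move=> z zy; apply: Hh; rewrite inE zy orbT.
Qed.

End step_comparison.

Section chain_probability.
Context {R : realType} {S : countType} (c : edge S -> R).
Hypothesis c_ge0 : forall e, 0 <= c e.
Hypothesis c_rate : forall x, (site_rate c x < +oo)%E.
Variable P : probability (borel (path_space R S)) R.
Hypothesis P_poisson : poisson_law c P.

Local Notation rate x := (fine (site_rate c x)).

Definition backtrack_follows x ys q : set (borel (path_space R S)) :=
  [set K | regular K /\ chain K x ys `[0, q]%classic].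

Lemma path_inS (F G : {fset edge S}) x ys : (F `<=` G)%fset ->
  path_in F x ys -> path_in G x ys.
Proof.
move=> FG; elim: ys x => //= y ys IH x [[e exy eF] /IH ?]; split=> //.
by exists e => //; exact: (fsubsetP FG).
Qed.

Lemma chain_path (K : path_space R S) x ys A : regular K -> chain K x ys A ->
  exists F : {fset edge S}, path_in F x ys.
Proof.
move=> regK; elim: ys x A => [|y ys IH] x A /=; first by exists fset0.
move=> [s [_ /(pair_jump_timeP regK)[e exy _] /IH[F pF]]].
exists (e |` F)%fset; split; first by exists e => //; rewrite !inE eqxx.
by apply: path_inS pF; exact: fsubsetU1.
Qed.

Lemma rates_approx (F0 : {fset edge S}) (zs : seq S) (delta : R) : 0 < delta ->
  exists F : {fset edge S}, (F0 `<=` F)%fset /\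
    forall z, z \in zs -> forall G : {fset edge S}, (F `<=` G)%fset ->
      rate z - rate_in G c z <= delta.
Proof.
move=> d0; elim: zs => [|z zs [F [FF HF]]]; first by exists F0.
have [F1 HF1] := rate_approx c_ge0 c_rate z d0.
exists (F `|` F1)%fset; split; first by apply: (fsubset_trans FF); exact: fsubsetUl.
move=> z'; rewrite inE => /orP[/eqP->|z'zs] G FG.
  by apply: HF1; apply: fsubset_trans FG; exact: fsubsetUr.
by apply: HF => //; apply: fsubset_trans FG; exact: fsubsetUl.
Qed.

Section one_walk.
Context d (Omega : measurableType d) (Q : probability Omega R)
  (x : S) (Y : nat -> Omega -> S) (tau : nat -> Omega -> \bar R).
Hypothesis walk : random_walk c Q x Y tau.

(** The first term bounds the probability that some cell contains two jumps of
    F, the second one the sum of the probabilities of the words. *)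
Lemma chain_cover (F0 : {fset edge S}) (ys : seq S) (q delta : R) :
  0 < q -> 0 < delta -> path_in F0 x ys ->
  ((P^*)%mu (backtrack_follows x ys q) <=
   delta%:E + (expR (delta * (q + 1)) ^+ size ys)%:E * Q (walk_follows x Y tau ys q))%E.
Proof.
move=> q0 d0 pF0; have [F [F0F HF]] := rates_approx F0 (x :: ys) d0.
have pF := path_inS F0F pF0.
pose pairs := [seq (e, e') | e <- enum_fset F, e' <- enum_fset F].
pose C := \sum_(p <- pairs) (c p.1 ^+ 2 + c p.1 * c p.2).
have C0 : 0 <= C by apply: sumr_ge0 => p _; rewrite addr_ge0 ?sqr_ge0// mulr_ge0.
(* With m cells, M / m bounds both the numbers rate z * h and the probability
   that some cell contains two jumps. *)
pose M := \sum_(z <- x :: ys) rate z * q + C * q ^+ 2.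
have rq0 z : 0 <= rate z * q by rewrite mulr_ge0 ?rate_ge0 ?(ltW q0).
have sum0 : 0 <= \sum_(z <- x :: ys) rate z * q by apply: sumr_ge0.
have Cq0 : 0 <= C * q ^+ 2 by rewrite mulr_ge0 ?sqr_ge0.
have [m m0 Mm] : exists2 m : nat, (0 < m)%N & M / m%:R <= delta.
  exists (Num.bound (M / delta)).+1 => //.
  rewrite ler_pdivrMr// mulrC -ler_pdivrMr// ltW//.
  by rewrite (lt_le_trans (archi_boundP _)) ?divr_ge0 ?addr_ge0 ?(ltW d0)// ler_nat.
have Hh z : z \in x :: ys -> rate z * (q / m%:R) <= delta.
  move=> zz; apply: le_trans Mm; rewrite mulrA ler_wpM2r ?invr_ge0//.
  rewrite (@le_trans _ _ (\sum_(z <- x :: ys) rate z * q))// ?lerDl//.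
  by rewrite (big_rem z)//= lerDl sumr_ge0.
have g0 j : 0 <= grid q m j by rewrite grid_ge0 ?(ltW q0).
have gS j : grid q m j <= grid q m j.+1 by rewrite grid_le ?(ltW q0).
pose B0 j (p : edge S * edge S) := two_jumps p.1 p.2 (grid q m j) (grid q m j.+1).
have mB0 j p : measurable (B0 j p) by exact: measurable_two_jumps.
pose B1 j := [set K | exists2 p, p \in pairs & B0 j p K].
have mB1 j : measurable (B1 j) by exact: measurable_exists_seq.
pose bad := [set K | exists2 j, j \in iota 0 m & B1 j K].
have mbad : measurable bad by exact: measurable_exists_seq.
have Pbad : (P bad <= delta%:E)%E.
  apply: (le_trans (measure_exists_seq _ _ mB1)).
  apply: (@le_trans _ _ (\sum_(j <- iota 0 m) (C * q ^+ 2 / m%:R ^+ 2)%:E)%E).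
    apply: lee_sum => j _; apply: (le_trans (measure_exists_seq _ _ (mB0 j))).
    rewrite -mulrA mulr_suml -sumEFin; apply: lee_sum => p _.
    apply: (le_trans (two_jumps_prob c_ge0 P_poisson _ _ _ _)) => //.
    by rewrite gridS expr_div_n.
  rewrite sumEFin lee_fin big_const_seq count_predT size_iota iter_addr_0.
  have aux (C' u : R) : u != 0 -> C' / u ^+ 2 * u = C' / u.
    by move=> u0; rewrite expr2 invfM -!mulrA mulVf// mulr1.
  rewrite -[leLHS]mulr_natr aux ?pnatr_eq0 -?lt0n//.
  by apply: le_trans Mm; rewrite ler_wpM2r ?invr_ge0// lerDr.
pose words := [seq l <- nat_words m (size ys) | (sumn [seq a.+1 | a <- l] <= m)%N].
pose E l := word_event F q m (m - steps l) (word x ys l).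
have mE l : measurable (E l) by exact: measurable_word_event (ltW q0) _ _.
apply: (@le_trans _ _ (P (bad `|` [set K | exists2 l, l \in words & E l K]))).
  apply: outer_measure_le; first by apply: measurableU => //; exact: measurable_exists_seq.
  move=> K [regK cK]; have [|nbad] := pselect (bad K); [by left|right].
  have simK : simple_cells F q m K.
    move=> j jm e e' eF e'F; have mono f := regular_nondecreasing regK f.
    apply: no_two_jumps; [exact: mono|exact: mono|] => tj.
    apply: nbad; exists j; first by rewrite mem_iota.
    by exists (e, e') => //; apply/allpairsP; exists (e, e').
  have [l [sl lm El]] := chain_word_start (ltW q0) m0 regK simK pF cK.
  exists l => //; rewrite mem_filter [X in X && _]lm mem_nat_words sl eqxx/=.
  exact: steps_small.
apply: (le_trans (measureU2 _ mbad (measurable_exists_seq _ mE))).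
apply: leeD => //; apply: (le_trans (measure_exists_seq _ _ mE)).
have w0 : (0 <= (expR (delta * (q + 1)) ^+ size ys)%:E)%E.
  by rewrite lee_fin exprn_ge0 ?expR_ge0.
have h0 : 0 < q / m%:R by rewrite divr_gt0// ltr0n.
have mh : m%:R * (q / m%:R) <= q by rewrite mulrC divfK// pnatr_eq0 -lt0n.
apply: le_trans (lee_wpmul2l w0 (walk_weight_sum walk ys h0 mh)).
rewrite -EFinM mulr_sumr -sumEFin -[X in (_ <= X)%E]big_filter -/words.
rewrite big_seq [leRHS]big_seq; apply: lee_sum => l.
rewrite mem_filter mem_nat_words => /andP[lm /andP[/eqP sl _]].
rewrite [X in (X <= _)%E](word_event_prob F m (ltW q0) P_poisson).
rewrite lee_fin; apply: word_weight_le => //; [exact: ltW|exact: ltW|].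
by move=> z zz; apply: HF.
Qed.

(** Let the mesh of the grid and the rates of the edges left out of F tend to 0
    in [chain_cover]. *)
Lemma chain_outer_measure (ys : seq S) (q : R) : 0 < q ->
  ((P^*)%mu (backtrack_follows x ys q) <=
   Q (walk_follows x Y tau ys q))%E.
Proof.
move=> q0; have [[F pF]|nF] := pselect (exists F, path_in F x ys); last first.
  rewrite (_ : backtrack_follows _ _ _ = set0) ?mu_ext0//.
  by apply/seteqP; split=> // K [regK /(chain_path regK)].
apply/lee_addgt0Pr => eps eps0.
pose L := (q + 1) * (size ys)%:R + 1.
have L0 : 0 < L by rewrite ltr_pwDr// mulr_ge0// addr_ge0// ltW.
have ln0 : 0 < ln (1 + eps / 2) by rewrite ln_gt0// ltrDl divr_gt0.
(* The additive error and the excess of the multiplicative one are then at most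
   eps / 2 each. *)
pose delta := Num.min (eps / 2) (ln (1 + eps / 2) / L).
have d0 : 0 < delta by rewrite lt_min !divr_gt0.
apply: (le_trans (chain_cover q0 d0 pF)).
have mW : measurable (walk_follows x Y tau ys q) by exact: measurable_walk_follows walk _ _.
set W := walk_follows x Y tau ys q in mW *.
have Qw : Q W = (fine (Q W))%:E by rewrite fineK// fin_num_measure.
have w0 : 0 <= fine (Q W) by rewrite fine_ge0.
have w1 : fine (Q W) <= 1 by rewrite -lee_fin -Qw; exact: probability_le1.
rewrite Qw -EFinM -!EFinD lee_fin; move: (fine (Q W)) w0 w1 => w w0 w1.
have d1 : delta <= eps / 2 by rewrite ge_min lexx.
have d2 : expR (delta * (q + 1)) ^+ size ys <= 1 + eps / 2.
  rewrite -expRM_natl -[leRHS]lnK ?posrE; last by rewrite addr_gt0// divr_gt0.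
  rewrite ler_expR; have : delta * L <= ln (1 + eps / 2).
    by rewrite -ler_pdivlMr// ge_min lexx orbT.
  by apply: le_trans; rewrite /L; lra.
have : expR (delta * (q + 1)) ^+ size ys * w <= (1 + eps / 2) * w by rewrite ler_wpM2r.
by move: d1 w0 w1 eps0; nra.
Qed.

End one_walk.
End chain_probability.

Section almost_sure_termination.
Context {R : realType} {S : countType} (c : edge S -> R).
Hypothesis c_ge0 : forall e, 0 <= c e.
Hypothesis c_rate : forall x, (site_rate c x < +oo)%E.
Variable P : probability (borel (path_space R S)) R.
Hypothesis P_poisson : poisson_law c P.

Section one_walk.
Context d (Omega : measurableType d) (Q : probability Omega R)
  (x : S) (Y : nat -> Omega -> S) (tau : nat -> Omega -> \bar R).
Hypothesis walk : random_walk c Q x Y tau.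
Hypothesis walk_ne : {ae Q, forall w, (\sum_(0 <= n <oo) tau n w = +oo)%E}.

Lemma walk_follows_sum n q :
  (\esum_(ys in [set ys : seq S | size ys = n]) Q (walk_follows x Y tau ys q) <=
   Q (fast tau n q))%E.
Proof.
have mW ys := measurable_walk_follows walk ys q.
apply: ge_ereal_sup => _ [X [finX XD] <-].
rewrite fsbig_finite//= -measure_exists_disjoint; first last.
- move=> ys ys'; rewrite !in_fset_set// !inE => /XD/= sy /XD/= sy' yy'.
  rewrite -subset0 => w [[H _] [H' _]]; move/eqP: yy'; apply.
  apply: (@eq_from_nth _ x); first by rewrite sy sy'.
  move=> i iy; have := H i.+1 iy; rewrite (H' i.+1) => [//|].
  by rewrite sy' -sy.
- exact: fset_uniq.
- by [].
apply: le_measure; rewrite ?inE.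
- exact: measurable_exists_seq.
- exact: measurable_fast walk _ _.
- move=> w [ys]; rewrite in_fset_set// inE => /XD/= sy [_].
  by rewrite /fast/= sy.
Qed.

Lemma backtrack_depth n q : 0 < q ->
  ((P^*)%mu [set K | exists2 ys : seq S, size ys = n & backtrack_follows x ys q K] <=
   Q (fast tau n q))%E.
Proof.
move=> q0; apply: le_trans (walk_follows_sum n q).
apply: (le_trans (outer_measure_exists_esum _ _ _)).
apply: le_esum => ys _; exact: (chain_outer_measure c_ge0 c_rate P_poisson walk).
Qed.

(** Infinitely many jumps by time q would be an explosion. *)
Lemma fast_small q (eps : R) : 0 < eps -> exists n, (Q (fast tau n q) <= eps%:E)%E.
Proof.
move=> eps0; have mf n := measurable_fast walk n q.
have [_ _ t0 _] := walk.
have mcap : measurable (\bigcap_n fast tau n q) by exact: bigcapT_measurable.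
have dec : {homo (fast tau ^~ q) : n m / (n <= m)%N >-> (n >= m)%O}.
  move=> n m nm; apply/subsetPset => w /=; rewrite /fast/=; apply: le_trans.
  rewrite -(big_mkord xpredT (tau^~ w)) -(big_mkord xpredT (tau^~ w)).
  exact: lee_sum_nneg_natr.
have cap0 : Q (\bigcap_n fast tau n q) = 0.
  apply: measure_negligible => //; move: walk_ne; apply: negligibleS => w Hw /= Hs.
  have : ((\sum_(0 <= n <oo) tau n w) <= q%:E)%E.
    apply: lime_le; first by apply: is_cvg_nneseries => *; exact: t0.
    by apply: nearW => n /=; have := Hw n I; rewrite /fast/= big_mkord.
  by rewrite Hs leye_eq.
have cv : Q \o fast tau ^~ q @ \oo --> (0 : \bar R)%E.
  rewrite -cap0; apply: nonincreasing_cvg_mu => //.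
  by rewrite -ge0_fin_numE// fin_num_measure.
apply: contrapT => /forallNP H.
have : (eps%:E <= 0)%E.
  apply: (cvge_ge _ cv); apply: nearW => n /=.
  by apply/ltW; rewrite ltNge; apply/negP.
by rewrite lee_fin leNgt eps0.
Qed.

Lemma nonstop_negligible q : 0 < q -> P.-negligible
  [set K : borel (path_space R S) | regular K /\ forall z, ~ backtrack K x `[0, q]%classic z].
Proof.
move=> q0; apply: negligible_mu_ext => eps eps0.
have [n Qn] := fast_small q eps0; apply: le_trans Qn.
apply: le_trans (backtrack_depth n q0); apply: le_mu_ext => K [regK ns].
have [|ys [sy cy]] := chain_of_nonstop regK _ ns n; last by exists ys.
by left; exists q => //; exact: ltW.
Qed.

End one_walk.

(** Nonexplosion rules out endless trajectories from each site and each rational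
    time, and rational times are enough by [nonstop_rational]. *)
Lemma Gamma_star_ae : (forall x, nonexplosive c x) ->
  P.-negligible (~` [set K : borel (path_space R S) | regular K /\ Gamma_star K]).
Proof.
move=> ne.
have c_site x : (\esum_(e in [set e : edge S | x \in val e]) (c e)%:E < +oo)%E.
  by rewrite -site_rate_edges.
have nq (i : S * rat) : P.-negligible [set K : borel (path_space R S) | regular K /\ 0 < i.2 /\
    forall z, ~ backtrack K i.1 `[0, ratr i.2 : R]%classic z].
  case: i => x q /=; have [q0|q0] := boolP (0 < q); last first.
    by apply: negligibleS (negligible_set0 P) => K [_ []].
  have [disp [W [Q [Y [tau [walk wne]]]]]] := ne x.
  have q0R : 0 < ratr q :> R by rewrite ltr0q.
  by apply: negligibleS (nonstop_negligible walk wne q0R) => K [? []].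
have := negligibleU (regular_ae c_ge0 P_poisson c_site) (negligible_exists nq).
apply: negligibleS => K HK; have [regK|] := pselect (regular K); [right|by left].
apply: contrapT => nK; apply: HK; split=> //; apply: regular_Gamma_star => // x q q0.
apply: contrapT => /forallNP ns; apply: nK; exists (x, q); split=> //.
Qed.

End almost_sure_termination.

(** * Sums over incident pairs of a site and an edge *)

Section incidence.
Context {R : realType} {S : choiceType}.

Lemma esum_endpoints (w : S -> \bar R) (e : edge S) : (forall x, 0 <= w x)%E ->
  (\esum_(x in [set x | x \in val e]) w x =
   w (endpoints e).1 + w (endpoints e).2)%E.
Proof.
move=> w0; rewrite (esum_finset (val e))// val_endpoints.
by rewrite big_fsetU1 ?inE ?endpoints_neq//= big_seq_fset1.
Qed.

(** Double counting of the incident pairs. *)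
Lemma esum_incidence (E : set (edge S)) (w : S -> edge S -> \bar R) :
  (forall x e, 0 <= w x e)%E ->
  (\esum_(x in [set: S]) \esum_(e in [set e : edge S | E e /\ x \in val e]) w x e =
   \esum_(e in E) (w (endpoints e).1 e + w (endpoints e).2 e))%E.
Proof.
move=> w0; rewrite esum_esum//.
rewrite -(eq_esum (fun e _ => esum_endpoints (w := w^~ e) e (w0^~ e))).

rewrite esum_esum//.
rewrite (reindex_esum (E `*`` (fun e : edge S => [set x | x \in val e])) _
  (fun p => (p.2, p.1)))//.
split=> [[e x] [/= Ee xe]|[e x] [e' x'] _ _ /= [-> ->]//|[x e] [_ /= [Ee xe]]].
  by split.
by exists (e, x).
Qed.

End incidence.

(** * Functions of finite total variation *)

Section variation.
Context {R : realType} {S : choiceType} (f : config S -> R).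

Lemma site_variation_ge0 x : (0 <= site_variation f x)%E.
Proof.
apply: ereal_sup_ubound; exists ((fun=> false) : config S, (fun=> false) : config S) => //=.
by rewrite subrr normr0.
Qed.

Lemma site_variation_ub (eta xi : config S) x : (forall y, y != x -> eta y = xi y) ->
  ((`|f eta - f xi|)%:E <= site_variation f x)%E.
Proof. by move=> H; apply: ereal_sup_ubound; exists (eta, xi). Qed.

Definition splice (A : {fset S}) (eta xi : config S) : config S :=
  fun x => if x \in A then eta x else xi x.

Lemma splice_variation (l : seq S) (eta xi : config S) : uniq l ->
  ((`|f (fun x => if x \in l then eta x else xi x) - f xi|)%:E <=
   \sum_(x <- l | eta x != xi x) site_variation f x)%E.
Proof.
elim: l => [_|x l IH /= /andP[xl ul]].
  rewrite big_nil (_ : (fun _ => _) = xi) ?subrr ?normr0//.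
rewrite big_cons; set a := (fun y => _); set b := (fun y => if y \in l then eta y else xi y).
have ab y : y != x -> a y = b y.
  by move=> yx; rewrite /a /b inE (negbTE yx).
case: eqP => [ex|nx]/=.
  rewrite (_ : a = b); first exact: IH.
  apply/funext => y; have [->|/ab//] := eqVneq y x.
  by rewrite /a /b mem_head (negbTE xl).
rewrite (_ : f a - f xi = (f a - f b) + (f b - f xi)); last by rewrite addrA subrK.
apply: (@le_trans _ _ ((`|f a - f b|)%:E + (`|f b - f xi|)%:E)%E).
  by rewrite -EFinD lee_fin ler_normD.
by apply: leeD; [exact: site_variation_ub|exact: IH].
Qed.

Lemma splice_cvg (eta xi : config S) :
  splice A eta xi @[A --> @summability.totally S] --> eta.
Proof.
have FF := summability.totally_filter (I := S).
apply/cvg_sup => x A [B [[C oC <-] /= Ceta] BA].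
apply: (filterS BA); exists [fset x]%fset => // D /= xD.
have {}xD : x \in D by apply: (fsubsetP xD); rewrite inE.
by rewrite /= /splice xD.
Qed.

(** Change the sites of a finite set one at a time, then let the finite set
    increase to S: the spliced configurations converge to eta. *)
Lemma config_variation_le (eta xi : config S) : continuous f ->
  ((`|f eta - f xi|)%:E <= \esum_(x in [set x | eta x != xi x]) site_variation f x)%E.
Proof.
move=> cf; have FF := summability.totally_filter (I := S).
have cv : (`|f (splice A eta xi) - f xi|)%:E @[A --> @summability.totally S] -->
    (`|f eta - f xi|)%:E.
  apply: cvg_EFin; first by apply: nearW.
  apply: cvg_norm; apply: cvgB; last exact: cvg_cst.
  apply: (@cvg_comp _ _ _ (fun A => splice A eta xi) f _ (nbhs eta)); last exact: cf.
  exact: splice_cvg.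
apply: (cvge_le _ cv); apply: nearW => A.
apply: (le_trans (splice_variation eta xi (fset_uniq A))).
rewrite big_fset_condE/=; apply: sum_le_esum.
  by move=> x _; exact: site_variation_ge0.
by move=> x; rewrite !inE/= => /andP[].
Qed.

End variation.

(** * Uniformly dominated series *)

(** Since u + a is nonnegative it can be summed over an arbitrary index set as an
    extended real number; the sum of a is then subtracted. *)
Lemma dominated_series (R : realType) (T : Type) (I : choiceType) (u : I -> T -> R)
    (a : I -> R) : (forall i, 0 <= a i) -> (forall i t, `|u i t| <= a i) ->
  (\esum_(i in [set: I]) (a i)%:E < +oo)%E ->
  exists g : T -> R, forall (F : {fset I}) t,
    ((`|\sum_(i <- F) u i t - g t|)%:E <= \esum_(i in ~` [set` F]) (a i)%:E)%E.
Proof.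
move=> a0 ua aoo; pose b t i := u i t + a i.
have b0 t i : 0 <= b t i.
  by have := ua i t; rewrite ler_norml => /andP[+ _]; rewrite /b; lra.
have b2 t i : b t i <= a i + a i.
  by have := ua i t; rewrite ler_norml => /andP[_ +]; rewrite /b; lra.
exists (fun t => fine (\esum_(i in [set: I]) (b t i)%:E) -
  fine (\esum_(i in [set: I]) (a i)%:E)) => F t.
have spl (h : I -> R) : (forall i, 0 <= h i) -> (\esum_(i in [set: I]) (h i)%:E =
    (\sum_(i <- F) h i)%:E + \esum_(i in ~` [set` F]) (h i)%:E)%E.
  move=> h0; rewrite (esumID [set` F]); last by move=> i _; rewrite lee_fin.
  have hE i : (0 <= (h i)%:E)%E by rewrite lee_fin.
  by rewrite !setTI -sumEFin (esum_finset F hE).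
have tb : (\esum_(i in ~` [set` F]) (b t i)%:E <=
    \esum_(i in ~` [set` F]) (a i)%:E + \esum_(i in ~` [set` F]) (a i)%:E)%E.
  rewrite -esumD; [|by move=> i _; rewrite lee_fin..].
  by apply: le_esum => i _; rewrite -EFinD lee_fin.
move: aoo; rewrite !spl//.
have : (0 <= \esum_(i in ~` [set` F]) (b t i)%:E)%E.
  by apply: esum_ge0 => i _; rewrite lee_fin.
have : (0 <= \esum_(i in ~` [set` F]) (a i)%:E)%E.
  by apply: esum_ge0 => i _; rewrite lee_fin.
move: tb; move: (esum _ (fun i => (a i)%:E)) (esum _ (fun i => (b t i)%:E)).
move=> [ta||] [tb||]//=; rewrite -?EFinD ?lee_fin// => h1 h2 h3 _.
rewrite /b big_split/= ler_norml; lra.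
Qed.

(** * Pointwise first-order expansion *)

Section pointwise_expansion.
Context {R : realType} {S : choiceType} (f : config S -> R).
Hypothesis f_continuous : continuous f.
Variable v : S -> R.
Hypothesis f_v : forall x, site_variation f x = (v x)%:E.

Definition edge_variation (e : edge S) : R := v (endpoints e).1 + v (endpoints e).2.

Lemma v_ge0 x : 0 <= v x.
Proof. by rewrite -lee_fin -f_v site_variation_ge0. Qed.

Lemma edge_variation_ge0 e : 0 <= edge_variation e.
Proof. by rewrite addr_ge0// v_ge0. Qed.

Lemma exchange_variation (e : edge S) (sigma : config S) :
  `|f (edge_exchange e sigma) - f sigma| <= edge_variation e.
Proof.
rewrite -lee_fin; apply: (le_trans (config_variation_le _ _ f_continuous)).
rewrite EFinD -!f_v -(esum_endpoints e (site_variation_ge0 f)).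
rewrite esum_mkcond [leRHS]esum_mkcond; apply: le_esum => x _.
case: ifPn; case: ifPn => //; last by move=> _ _; exact: site_variation_ge0.
rewrite !inE/= => xe; rewrite edge_exchangeE other_notin ?eqxx//.
by apply/negP => ?; move: xe; rewrite notin_setE.
Qed.

(** Each changed site is charged to an edge that has jumped there. *)
Lemma covered_variation (E : set (edge S)) (J : edge S -> bool) (eta xi : config S) :
  (forall x, eta x != xi x -> exists e : edge S, [/\ x \in val e, E e & J e]) ->
  ((`|f eta - f xi|)%:E <= \esum_(e in E) ((J e)%:R * edge_variation e)%:E)%E.
Proof.
move=> cov; apply: (le_trans (config_variation_le _ _ f_continuous)).
pose w x (e : edge S) : \bar R := ((J e)%:R * v x)%:E.
have w0 x e : (0 <= w x e)%E by rewrite lee_fin mulr_ge0 ?v_ge0.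
rewrite (eq_esum (b := fun e => (w (endpoints e).1 e + w (endpoints e).2 e)%E)); last first.
  by move=> e _; rewrite /w -EFinD -mulrDr.
rewrite -esum_incidence// esum_mkcond; apply: le_esum => x _.
case: ifPn => [|_]; last exact: esum_ge0.
rewrite inE/= => /cov[e [xe Ee Je]].
apply: esum_ge; exists [set e]; first by split=> // e' ->.
by rewrite fsbig_set1 /w Je mul1r f_v.
Qed.

Variables (K : path_space R S) (regK : regular K).
Variables (F : {fset edge S}) (t : R) (t_ge0 : 0 <= t).

Definition jumped (e : edge S) : bool := (0 < K e t)%N.

(** The ways in which a jump of an edge of F may fail to be a plain exchange of
    its endpoints. *)
Definition interference : Prop := exists2 e, e \in F & jumped e /\
  ((1 < K e t)%N \/ exists e', [/\ e' != e, jumped e' &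
     e' \in F \/ exists2 x, x \in val e & x \in val e']).

Lemma exclusion_no_jump sigma x : (forall e : edge S, x \in val e -> ~~ jumped e) ->
  exclusion K t sigma x = sigma x.
Proof.
move=> H; rewrite /exclusion (flow_no_jump regK)// => e /H.
by rewrite /jumped lt0n negbK => /eqP.
Qed.

(** Without interference at most one edge of F has jumped; if so, its endpoints
    are exactly exchanged, and any other changed site is touched by a jump of an
    edge outside F. *)
Lemma expansion_remainder (sigma : config S) : ~ interference ->
  ((`|f (exclusion K t sigma) - f sigma -
      \sum_(e <- F) (jumped e)%:R * (f (edge_exchange e sigma) - f sigma)|)%:E <=
   \esum_(e in ~` [set` F]) ((jumped e)%:R * edge_variation e)%:E)%E.
Proof.
move=> nI.
have jump_at sig x : exclusion K t sig x != sig x ->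
    exists2 e : edge S, x \in val e & jumped e.
  move=> ne; apply: contrapT => H; move/eqP: ne; apply.
  apply: exclusion_no_jump => e xe; apply/negP => je; apply: H; by exists e.
have [[e0 e0F je0]|nF] := pselect (exists2 e, e \in F & jumped e); last first.
  rewrite big_seq big1 ?subr0; last first.
    move=> e eF; case je : (jumped e); last by rewrite mul0r.
    by exfalso; apply: nF; exists e.
  apply: covered_variation => x /jump_at[e xe je]; exists e; split=> //.
  by move=> /= eF; apply: nF; exists e.
have nj e : e != e0 -> e \in F \/ (exists2 x, x \in val e0 & x \in val e) -> ~~ jumped e.
  move=> ee0 He; apply/negP => je; apply: nI; exists e0 => //; split=> //.
  by right; exists e.
have K1 : K e0 t = 1%N.
  apply/eqP; rewrite eqn_leq [X in _ && X]je0 andbT leqNgt; apply/negP => K2.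
  by apply: nI; exists e0 => //; split=> //; left.
have -> : \sum_(e <- F) (jumped e)%:R * (f (edge_exchange e sigma) - f sigma) =
    f (edge_exchange e0 sigma) - f sigma.
  rewrite (big_fsetD1 e0)//= je0 mul1r big_seq big1 ?addr0// => e.
  rewrite in_fsetD1 => /andP[ee0 eF].
  by rewrite (negbTE (nj _ ee0 (or_introl eF))) mul0r.
rewrite opprB addrA subrK; apply: covered_variation => x.
have [xe0|xe0] := boolP (x \in val e0).
  rewrite {1}/exclusion (flow_single_jump regK t_ge0 xe0 K1).
    by rewrite edge_exchangeE eqxx.
  move=> e' e'e0 xe'; have : ~~ jumped e'.
    apply: nj => //; right; case: xe' => xe'; first by exists x.
    exists (other e0 x) => //; exact: edge_of_memr (edge_of_other xe0).
  by rewrite /jumped lt0n negbK => /eqP.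
rewrite edge_exchangeE (other_notin xe0) => /jump_at[e xe je]; exists e; split=> //= eF.
have ee0 : e != e0 by apply: contraNneq xe0 => <-.
by have := nj e ee0 (or_introl eF); rewrite je.
Qed.

End pointwise_expansion.

(** * Integrals of possibly non-measurable functions *)

Section integration.
Context d (T : measurableType d) (R : realType) (P : probability T R).

(** The integral of a nonnegative function is a supremum over the simple functions
    below it, whether or not the function is measurable. *)
Lemma ge0_le_lower_integral (f g : T -> \bar R) :
  (forall w, 0 <= f w)%E -> (forall w, f w <= g w)%E ->
  (\int[P]_w f w <= \int[P]_w g w)%E.
Proof.
move=> f0 fg; rewrite ge0_integralTE// ge0_integralTE; last first.
  by move=> w; exact: le_trans (fg w).
apply: ge_ereal_sup => _ [h hf <-]; apply: ereal_sup_ubound; exists h => //= w.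
exact: le_trans (fg w).
Qed.

Lemma le_lower_integral (f g : T -> \bar R) : (forall w, f w <= g w)%E ->
  (\int[P]_w f w <= \int[P]_w g w)%E.
Proof.
move=> fg; rewrite integralE [leRHS]integralE.
apply: leeB; apply: ge0_le_lower_integral => // w.
  by rewrite !funeposE ge_max !le_max fg lexx orbT.
by rewrite !funenegE ge_max !le_max leeN2 fg lexx orbT.
Qed.

(** H lies between phi - W and phi + W, and the integral is monotone even for
    H non-measurable; linearity is only used for phi and W. *)
Lemma integral_sandwich (H phi : T -> R) (W : T -> \bar R) :
  P.-integrable setT (EFin \o phi) -> P.-integrable setT W ->
  (forall w, (`|H w - phi w|)%:E <= W w)%E ->
  ((`|\int[P]_w H w - \int[P]_w phi w|)%:E <= \int[P]_w W w)%E.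
Proof.
move=> iphi iW HW.
have hi : (\int[P]_w (H w)%:E <= \int[P]_w ((phi w)%:E + W w))%E.
  apply: le_lower_integral => w; have := HW w; case: (W w) => [r||//] /=.
    by rewrite !lee_fin ler_norml; lra.
  by rewrite addey// => _; exact: leey.
have lo : (\int[P]_w ((phi w)%:E - W w) <= \int[P]_w (H w)%:E)%E.
  apply: le_lower_integral => w; have := HW w; case: (W w) => [r||//] /=.
    by rewrite !lee_fin ler_norml; lra.
  by move=> _; exact: leNye.
move: hi lo; rewrite integralD// integralB//.
have fp := integrable_fin_num measurableT iphi.
have fW := integrable_fin_num measurableT iW.
rewrite /Rintegral; move: fp fW; rewrite /comp.
move: (integral P _ (fun w => (phi w)%:E)) (integral P _ W)
  (integral P _ (fun w => (H w)%:E)).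
move=> [p||] [q||] [h||]//= _ _; rewrite -?EFinD -?EFinB ?lee_fin//= ler_norml.
lra.
Qed.

Lemma Rintegral_indic_sum (I : Type) (s : seq I) (A : I -> set T) (a : I -> R) :
  (forall i, measurable (A i)) ->
  P.-integrable setT (EFin \o (fun w => \sum_(i <- s) a i * \1_(A i) w)) /\
  \int[P]_w (\sum_(i <- s) a i * \1_(A i) w) = \sum_(i <- s) a i * fine (P (A i)).
Proof.
move=> mA; elim: s => [|i s [iS eS]].
  rewrite (_ : (fun w => _) = cst 0); last by apply/funext => w; rewrite big_nil.
  split; first exact: integrable0.
  by rewrite big_nil Rintegral_cst// mul0r.
have iA : P.-integrable setT (EFin \o \1_(A i)) by exact: integrable_indic.
have iaA : P.-integrable setT (EFin \o (fun w => a i * \1_(A i) w)).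
  rewrite (_ : _ \o _ = (fun w => (a i)%:E * (\1_(A i) w)%:E)%E); last exact/funext.
  exact: integrableZl.
rewrite (_ : (fun w => _) = (fun w => a i * \1_(A i) w +
    \sum_(i <- s) a i * \1_(A i) w)); last by apply/funext => w; rewrite big_cons.
split.
  rewrite (_ : _ \o _ = (EFin \o (fun w => a i * \1_(A i) w)) \+
    (EFin \o (fun w => \sum_(i <- s) a i * \1_(A i) w))); last exact/funext.
  exact: integrableD.
rewrite RintegralD// eS big_cons RintegralZl//; congr (_ * _ + _).
by rewrite /Rintegral integral_indic// setIT.
Qed.

Lemma integral_esum (I : countType) (D : set I) (h : I -> T -> \bar R) :
  (forall i, measurable_fun setT (h i)) -> (forall i w, 0 <= h i w)%E ->
  measurable_fun setT (fun w => \esum_(i in D) h i w)%E /\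
  (\int[P]_w (\esum_(i in D) h i w) = \esum_(i in D) \int[P]_w h i w)%E.
Proof.
move=> mh h0.
(* The sum as a series over the naturals; with pickle_inv no index occurs
   twice. *)
pose ser (a : I -> \bar R) (n : nat) : \bar R :=
  if choice.pickle_inv n is Some i then (if i \in D then a i else 0%E) else 0%E.
have ser0 a n : (forall i, 0 <= a i)%E -> (0 <= ser a n)%E.
  by move=> a0; rewrite /ser; case: choice.pickle_inv => // i; case: ifP.
have serE (a : I -> \bar R) : (forall i, 0 <= a i)%E ->
    (\esum_(i in D) a i = \sum_(n <oo) ser a n)%E.
  move=> a0; rewrite nneseries_esumT => [|n]; last exact: ser0.
  rewrite esum_mkcond (eq_esum (b := ser a \o choice.pickle)); last first.
    by move=> i _; rewrite /ser/= choice.pickleK_inv.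
  rewrite -(esum_image setT choice.pickle (ser a)); last first.
    by move=> i j _ _ /(pcan_inj choice.pickleK).
  rewrite esum_mkcond; apply: eq_esum => n _; case: ifPn => //.
  rewrite notin_setE/= /ser => nI; have := @choice.pickle_invK I n.
  by case: choice.pickle_inv => //= i ni; exfalso; apply: nI; exists i.
rewrite (_ : (fun w => _) = (fun w => \sum_(n <oo) ser (h^~ w) n)%E); last first.
  by apply/funext => w; rewrite serE.
have ms n : measurable_fun setT (fun w => ser (h^~ w) n).
  rewrite /ser; case: choice.pickle_inv => [i|]; last exact: measurable_cst.
  by case: (i \in D); [exact: mh|exact: measurable_cst].
split.
  rewrite (_ : (fun w => _) = (fun w => \sum_(n <oo | n \in xpredT) ser (h^~ w) n)%E)//.
  apply: ge0_emeasurable_sum => //.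
  by move=> n w _ _; exact: ser0.
rewrite integral_nneseries//; last by move=> n w _; exact: ser0.
rewrite serE; last by move=> i; exact: integral_ge0.
apply: eq_eseriesr => n _; rewrite /ser; case: choice.pickle_inv => [i|].
  by case: (i \in D) => //; rewrite integral0.
by rewrite integral0.
Qed.

End integration.

(** * The semigroup at small times *)

Section small_times.
Context {R : realType} {S : countType} (c : edge S -> R).
Hypothesis c_ge0 : forall e, 0 <= c e.
Hypothesis c_rate : forall x, (site_rate c x < +oo)%E.
Variable P : probability (borel (path_space R S)) R.
Hypothesis P_poisson : poisson_law c P.
Hypothesis Gamma_star_as : P.-negligible (~` [set K | regular K /\ Gamma_star K]).
Variable f : config S -> R.
Hypothesis f_continuous : continuous f.
Variable v : S -> R.
Hypothesis f_v : forall x, site_variation f x = (v x)%:E.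
Hypothesis f_rate_var :
  (\esum_(x in [set: S]) (site_rate c x * site_variation f x) < +oo)%E.
Variable B : R.
Hypothesis f_B : forall eta, `|f eta| <= B.

Local Notation rate x := (fine (site_rate c x)).

(** Double counting; in particular the series of the exclusion terms is
    absolutely convergent. *)
Lemma esum_rate_variation :
  (\esum_(e in [set: edge S]) (c e * edge_variation v e)%:E <=
   \esum_(x in [set: S]) (site_rate c x * site_variation f x))%E.
Proof.
have v0 := v_ge0 f_v.
rewrite (eq_esum (b := fun e => ((c e * v (endpoints e).1)%:E +
    (c e * v (endpoints e).2)%:E)%E)); last first.
  by move=> e _; rewrite -EFinD -mulrDr.
rewrite -(esum_incidence _ (w := fun x e => (c e * v x)%:E)); last first.
  by move=> x e; rewrite lee_fin mulr_ge0.
apply: le_esum => x _; rewrite f_v site_rate_edges// muleC.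
apply: le_trans (le_esumZl _ (v0 x)); last by move=> e _; rewrite lee_fin.
rewrite (_ : [set e | setT e /\ _] = [set e : edge S | x \in val e]); last first.
  by apply/seteqP; split=> e /=; [case|split].
by apply: le_esum => e _; rewrite -EFinM mulrC.
Qed.

Section fix_F.
Variable F : {fset edge S}.

Let pairs := [seq (e, e') | e <- enum_fset F, e' <- enum_fset F].

Let ends := [seq (e, x) | e <- enum_fset F, x <- [:: (endpoints e).1; (endpoints e).2]].

(** A measurable event that contains interference. *)
Definition crowded (t : R) : set (borel (path_space R S)) :=
  [set K | exists2 p, p \in pairs & two_jumps p.1 p.2 0 t K] `|`
  [set K | exists2 p, p \in ends & exists2 e, [set e : edge S | p.2 \in val e] e &
     both_jump p.1 e 0 t K].

Let measurable_ends (p : edge S * S) t : 0 <= t ->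
  measurable [set K : borel (path_space R S) |
    exists2 e, [set e : edge S | p.2 \in val e] e & both_jump p.1 e 0 t K].
Proof. by move=> t0; apply: measurable_exists => e; exact: measurable_both_jump. Qed.

Let measurable_pairs (p : edge S * edge S) t : 0 <= t ->
  measurable (two_jumps p.1 p.2 0 t : set (borel (path_space R S))).
Proof. by move=> t0; exact: measurable_two_jumps. Qed.

Lemma measurable_crowded t : 0 <= t -> measurable (crowded t).
Proof.
move=> t0; apply: measurableU.
  by apply: measurable_exists_seq => p; exact: measurable_pairs.
by apply: measurable_exists_seq => p; exact: measurable_ends.
Qed.

Definition crowded_const : R :=
  \sum_(p <- pairs) (c p.1 ^+ 2 + c p.1 * c p.2) + \sum_(p <- ends) c p.1 * rate p.2.

Lemma crowded_const_ge0 : 0 <= crowded_const.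
Proof.
apply: addr_ge0; apply: sumr_ge0 => p _.
  by rewrite addr_ge0 ?sqr_ge0// mulr_ge0.
by rewrite mulr_ge0// rate_ge0.
Qed.

Lemma crowded_prob t : 0 <= t -> (P (crowded t) <= (crowded_const * t ^+ 2)%:E)%E.
Proof.
move=> t0; apply: (le_trans (measureU2 _ _ _)).
- by apply: measurable_exists_seq => p; exact: measurable_pairs.
- by apply: measurable_exists_seq => p; exact: measurable_ends.
rewrite mulrDl EFinD; apply: leeD.
  apply: (le_trans (measure_exists_seq _ _ (fun p => measurable_pairs p t0))).
  rewrite mulr_suml -sumEFin; apply: lee_sum => p _.
  by apply: (le_trans (two_jumps_prob c_ge0 P_poisson _ _ _ _)) => //; rewrite subr0.
apply: (le_trans (measure_exists_seq _ _ (fun p => measurable_ends p t0))).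
rewrite mulr_suml -sumEFin; apply: lee_sum => p _.
apply: (le_trans (measure_exists_esum _ _ _)).
  by move=> e; exact: measurable_both_jump.
apply: (@le_trans _ _ (\esum_(e in [set e : edge S | p.2 \in val e])
    ((c p.1 * t ^+ 2)%:E * (c e)%:E))%E).
  apply: le_esum => e _; rewrite -EFinM mulrAC -[t in t ^+ 2]subr0.
  exact: (both_jump_prob c_ge0 P_poisson).
apply: (le_trans (le_esumZl _ _)).
- by move=> e _; rewrite lee_fin.
- by rewrite mulr_ge0 ?sqr_ge0.
by rewrite -site_rate_edges// site_rate_fin// -EFinM lee_fin mulrAC.
Qed.

Lemma interference_crowded (K : path_space R S) t : 0 <= t -> regular K ->
  interference K F t -> crowded t K.
Proof.
move=> t0 regK [e eF [je H]].
have jE e' : jumped K t e' -> jumps e' 0 t K.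
  by move=> je'; apply/jumpsE; rewrite (regular0 regK).
case: H => [K2|[e' [e'e je' [e'F|[x xe xe']]]]].
- left; exists (e, e); first by apply/allpairsP; exists (e, e).
  by left; exists (K e t); rewrite //= (regular0 regK).
- left; exists (e, e'); first by apply/allpairsP; exists (e, e').
  by right; rewrite /both_jump/= eq_sym (negbTE e'e); split; exact: jE.
- right; exists (e, x); last first.
    by exists e' => //; rewrite /both_jump eq_sym (negbTE e'e); split; exact: jE.
  by apply/allpairsPdep; exists e, x; split=> //; move: xe; rewrite in_edge !inE.
Qed.

(** Outside an event of probability O(t^2) the integrand is expanded by
    [expansion_remainder], whose right-hand side has expectation at most t times
    the tail of the series. *)
Lemma semigroup_expansion : exists2 C, 0 <= C & forall t sigma, 0 < t ->
  ((`|semigroup P t f sigma - f sigma - \sum_(e <- F)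
        fine (P (jumps e 0 t)) * (f (edge_exchange e sigma) - f sigma)|)%:E <=
   (t%:E * \esum_(e in ~` [set` F]) (c e * edge_variation v e)%:E) + (C * t ^+ 2)%:E)%E.
Proof.
have B0 : 0 <= B := le_trans (normr_ge0 _) (f_B (fun=> false)).
(* C0 bounds the error of the expansion on the exceptional event. *)
pose C0 := 2 * B + \sum_(e <- F) (2 * B).
have C00 : 0 <= C0 by rewrite addr_ge0 ?mulr_ge0// sumr_ge0// => e _; rewrite mulr_ge0.
exists (C0 * crowded_const); first by rewrite mulr_ge0// crowded_const_ge0.
move=> t sigma t0; have t0' := ltW t0.
have [N [mN N0 HN]] := Gamma_star_as.
pose d e := f (edge_exchange e sigma) - f sigma.
have dB e : `|d e| <= 2 * B.
  rewrite (le_trans (ler_normB _ _))// mulrDl mul1r lerD//.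
have mJ e : measurable (jumps e 0 t : set (borel (path_space R S))).
  exact: measurable_edge_increment.
pose H : borel (path_space R S) -> R := (fun K => f (exclusion K t sigma)) \_ Gamma_star.
have HB K : `|H K| <= B.
  by rewrite /H /patch; case: ifP => _; rewrite ?normr0.
pose phi (K : borel (path_space R S)) : R :=
  f sigma + \sum_(e <- F) d e * \1_(jumps e 0 t) K.
have [iS eS] := Rintegral_indic_sum P (enum_fset F) d mJ.
have icst : P.-integrable setT (EFin \o cst (f sigma)).
  exact: finite_measure_integrable_cst.
have iphi : P.-integrable setT (EFin \o phi).
  rewrite (_ : _ \o _ = (EFin \o cst (f sigma)) \+
    (EFin \o (fun K => \sum_(e <- F) d e * \1_(jumps e 0 t) K))); last exact/funext.
  exact: integrableD.
have ephi : \int[P]_K phi K = f sigma + \sum_(e <- F) fine (P (jumps e 0 t)) * d e.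
  rewrite RintegralD// eS Rintegral_cst//; congr (_ + _).
    rewrite -[RHS]mulr1; congr (_ * _); exact: (congr1 fine (probability_setT P)).
  by apply: eq_bigr => e _; rewrite mulrC.
pose Z (K : borel (path_space R S)) : \bar R :=
  (\esum_(e in ~` [set` F]) (edge_variation v e * \1_(jumps e 0 t) K)%:E)%E.
pose A := crowded t `|` N.
have mA : measurable A by apply: measurableU => //; exact: measurable_crowded.
have ev0 e := edge_variation_ge0 f_v e.
have h0 e K : (0 <= (edge_variation v e * \1_(jumps e 0 t) K)%:E)%E.
  by rewrite lee_fin mulr_ge0.
have mh e : measurable_fun setT (fun K : borel (path_space R S) =>
    (edge_variation v e * \1_(jumps e 0 t) K)%:E).
  by apply/measurable_EFinP; apply: measurable_funM => //; exact: measurable_indic.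
have [mZ eZ] := integral_esum P (~` [set` F]) mh h0.
have Zle : (\int[P]_K Z K <=
    t%:E * \esum_(e in ~` [set` F]) (c e * edge_variation v e)%:E)%E.
  rewrite eZ; apply: (@le_trans _ _
      (\esum_(e in ~` [set` F]) (t%:E * (c e * edge_variation v e)%:E))%E); last first.
    by apply: le_esumZl => // e _; rewrite lee_fin mulr_ge0.
  apply: le_esum => e _.
  rewrite (_ : (fun K => _) = (fun K => (edge_variation v e)%:E *
    (\1_(jumps e 0 t) K)%:E)%E); last exact/funext.
  rewrite ge0_integralZl_EFin//; last exact/measurable_EFinP/measurable_indic.
  rewrite integral_indic// setIT.
  apply: (@le_trans _ _ ((edge_variation v e)%:E * (c e * (t - 0))%:E)%E).
    by rewrite lee_wpmul2l ?lee_fin//; exact: jumps_prob_le.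
  by rewrite -!EFinM lee_fin subr0 (_ : _ * (c e * t) = t * (c e * edge_variation v e)) //; ring.
have tail_lty : (\esum_(e in ~` [set` F]) (c e * edge_variation v e)%:E < +oo)%E.
  apply: le_lt_trans (le_lt_trans esum_rate_variation f_rate_var).
  rewrite esum_mkcond; apply: le_esum => e _.
  by case: ifP => // _; rewrite lee_fin mulr_ge0.
have Z0 K : (0 <= Z K)%E by exact: esum_ge0.
have Zlty : (\int[P]_K Z K < +oo)%E.
  apply: (le_lt_trans Zle); move: tail_lty.
  have : (0 <= \esum_(e in ~` [set` F]) (c e * edge_variation v e)%:E)%E.
    by apply: esum_ge0 => e _; rewrite lee_fin mulr_ge0.
  by case: (esum _ _) => [r||]// _ _; rewrite -EFinM ltry.
have iZ : P.-integrable setT Z.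
  apply/integrableP; split=> //; apply: le_lt_trans Zlty.
  by apply: ge0_le_lower_integral => K; [exact: abse_ge0|rewrite gee0_abs].
have iA : P.-integrable setT (fun K => C0%:E * (\1_A K)%:E)%E.
  by apply: integrableZl => //; exact: integrable_indic.
pose W K := (Z K + C0%:E * (\1_A K)%:E)%E.
have iW : P.-integrable setT W by exact: integrableD.
have eW : (\int[P]_K W K <= (t%:E * \esum_(e in ~` [set` F])
    (c e * edge_variation v e)%:E) + (C0 * crowded_const * t ^+ 2)%:E)%E.
  rewrite integralD//; apply: leeD => //.
  rewrite ge0_integralZl_EFin//; last exact/measurable_EFinP/measurable_indic.
  rewrite integral_indic// setIT -mulrA EFinM lee_wpmul2l ?lee_fin//.
  apply: (le_trans (measureU2 P (measurable_crowded t0') mN)).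
  rewrite [X in (_ + X)%E]N0 adde0; exact: crowded_prob.
have HW K : ((`|H K - phi K|)%:E <= W K)%E.
  have [AK|AK] := pselect (A K).
    rewrite /W indicE mem_set// mule1; apply: (@le_trans _ _ C0%:E); last exact: leeDr.
    rewrite lee_fin /phi opprD addrA (le_trans (ler_normB _ _))// /C0.
    apply: lerD.
      by rewrite (le_trans (ler_normB _ _))// mulrDl mul1r lerD.
    rewrite (le_trans (ler_norm_sum _ _ _))// ler_sum// => e _.
    rewrite normrM indicE normr_nat -[leRHS]mulr1 ler_pM//.
    by case: (_ \in _).
  have [regK starK] : regular K /\ Gamma_star K.
    by apply: contrapT => nK; apply: AK; right; exact: HN.
  have nI : ~ interference K F t.
    by move=> I; apply: AK; left; exact: interference_crowded.
  rewrite /W indicE memNset// mule0 adde0.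
  have jE e : \1_(jumps e 0 t) K = (jumped K t e)%:R :> R.
    rewrite indicE; congr ((nat_of_bool _)%:R); apply/idP/idP.
      by rewrite inE => /jumpsE; rewrite (regular0 regK).
    by move=> je; rewrite inE; apply/jumpsE; rewrite (regular0 regK).
  have := expansion_remainder f_continuous f_v regK t0' sigma nI.
  rewrite /H /patch mem_set// /phi opprD addrA.
  rewrite (eq_bigr (fun e => d e * \1_(jumps e 0 t) K)); last first.
    by move=> e _; rewrite jE mulrC.
  rewrite /Z (eq_esum (b := fun e => (edge_variation v e * \1_(jumps e 0 t) K)%:E))//.
  by move=> e _; rewrite jE mulrC.
have := integral_sandwich iphi iW HW; rewrite ephi => Hfin.
apply: le_trans eW; apply: le_trans Hfin.
by rewrite /semigroup Rintegral_mkcond opprD addrA.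
Qed.

End fix_F.
End small_times.

(** * Uniform convergence and uniqueness of the generator *)

Section uniform_convergence.
Context {R : realType}.

Lemma cvg_ereal0P {T : Type} (F : set_system T) {FF : Filter F} (h : T -> \bar R) :
  (forall t, 0 <= h t)%E ->
  (h t @[t --> F] --> 0%E) <->
  (forall eps : R, 0 < eps -> \forall t \near F, (h t <= eps%:E)%E).
Proof.
move=> h0; split=> [cv eps eps0|H A].
  have : nbhs (0 : \bar R)%E [set y : \bar R | (y <= eps%:E)%E].
    exists eps => //= y /=; rewrite sub0r normrN => /ltW ye.
    by rewrite lee_fin (le_trans (ler_norm _)).
  by move=> /cv.
move=> [eps /= eps0 HA]; have e2 : 0 < eps / 2 by rewrite divr_gt0.
apply: filterS (H _ e2) => t /=; have := h0 t.
case: (h t) => [r||]//; rewrite !lee_fin => r0 re; apply: HA => /=.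
by rewrite sub0r normrN ger0_norm//; lra.
Qed.

Context {S : choiceType}.

Lemma sup_norm_ge0 (f : config S -> R) : (0 <= sup_norm f)%E.
Proof.
apply: (@le_trans _ _ (`|f (fun=> false)|%:E)%E); first by rewrite lee_fin.
by apply: ereal_sup_ubound; exists (fun=> false).
Qed.

Lemma sup_norm_le (f : config S -> R) (r : \bar R) :
  (forall eta, (`|f eta|%:E <= r)%E) -> (sup_norm f <= r)%E.
Proof. by move=> H; apply: ge_ereal_sup => _ [eta _ <-]. Qed.

Lemma le_sup_norm (f : config S -> R) eta : (`|f eta|%:E <= sup_norm f)%E.
Proof. by apply: ereal_sup_ubound; exists eta. Qed.

Variable P : probability (borel (path_space R S)) R.

Lemma generator_limit_unique (f g1 g2 : config S -> R) :
  generator_limit P f g1 -> generator_limit P f g2 -> g1 = g2.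
Proof.
move=> [_ _ c1] [_ _ c2]; apply/funext => eta; apply/eqP; rewrite -subr_eq0 -normr_eq0.
rewrite eq_le normr_ge0 andbT; apply/ler_addgt0Pr => eps eps0; rewrite add0r.
have e2 : 0 < eps / 2 by rewrite divr_gt0.
have FR : Filter (0 : R)^'+ by exact: within_filter.
have n1 := (@cvg_ereal0P _ (0 : R)^'+ FR _ (fun t => sup_norm_ge0 _)).1 c1 _ e2.
have n2 := (@cvg_ereal0P _ (0 : R)^'+ FR _ (fun t => sup_norm_ge0 _)).1 c2 _ e2.
have [t [h1 h2]] := filter_ex (filterI n1 n2).
have := le_trans (le_sup_norm _ eta) h1; have := le_trans (le_sup_norm _ eta) h2.
rewrite !lee_fin; set a := (_ / t); rewrite !ler_norml; lra.
Qed.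

Lemma generatorE (f g : config S -> R) : generator_limit P f g -> generator P f = g.
Proof.
move=> H; rewrite /generator; apply: xget_subset1 => //.
by move=> g1 g2 /= H1 H2; exact: generator_limit_unique H1 H2.
Qed.

End uniform_convergence.

Lemma continuous_edge_exchange {S : choiceType} (e : edge S) :
  continuous (@edge_exchange S e).
Proof.
move=> sigma; apply/cvg_sup => x A [D [[C oC <-] /= Csigma] DA].
have pc : continuous (proj (other e x) : config S -> bool).
  by move=> K; exact: proj_continuous.
rewrite edge_exchangeE in Csigma.
have nb : nbhs (sigma (other e x)) C by apply: open_nbhs_nbhs; split.
have H : nbhs sigma (proj (other e x) @^-1` C) := pc sigma C nb.
change (nbhs sigma (edge_exchange e @^-1` A)).
apply: filterS H => tau /= Ctau.
by apply: DA => /=; rewrite edge_exchangeE.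
Qed.

Lemma continuous_exclusion_term {R : realType} {S : choiceType} (c : edge S -> R)
    (f : config S -> R) (e : edge S) :
  continuous f -> continuous (exclusion_term c f e).
Proof.
move=> cf sigma; apply: cvgM; first exact: cvg_cst.
apply: cvgB; last exact: cf.
apply: (@cvg_comp _ _ _ (edge_exchange e) f _ (nbhs (edge_exchange e sigma))).
  exact: continuous_edge_exchange.
exact: cf.
Qed.

Lemma one_sub_expRN_approx {R : realType} (u : R) : 0 <= u ->
  `|1 - expR (- u) - u| <= u ^+ 2.
Proof.
move=> u0; have h1 := expR_ge1Dx (- u).
have h2 : expR u * expR (- u) = 1 by rewrite -expRD subrr expR0.
have h3 := expR_ge1Dx u; have h4 := expR_ge0 (- u).
rewrite ler_norml; nra.
Qed.

Theorem proposition3p5 (R : realType) (S : countType)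
  (S_infinite : infinite_set [set: S])
  (c : edge S -> R) (c_ge0 : forall e, 0 <= c e)
  (c_SSEP : assumption_SSEP c)
  (P : probability (borel (path_space R S)) R) (P_poisson : poisson_law c P)
  (f : config S -> R) (f_continuous : continuous f)
  (f_var : (\esum_(x in [set: S]) site_variation f x < +oo)%E)
  (f_rate_var :
    (\esum_(x in [set: S]) (site_rate c x * site_variation f x) < +oo)%E) :
  [/\ generator_domain P f,
      absolutely_convergent (exclusion_term c f) &
      series_sum (exclusion_term c f) (generator P f)].
Proof.
have [c_rate c_ne] := c_SSEP.
have sv0 := site_variation_ge0 f.
pose v x := fine (site_variation f x).
have f_v x : site_variation f x = (v x)%:E.
  rewrite fineK// ge0_fin_numE//; apply: le_lt_trans f_var.
  by apply: esum_ge; exists [set x] => //; rewrite fsbig_set1.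
have V_fin : (\esum_(x in [set: S]) site_variation f x)%E \is a fin_num.
  by rewrite ge0_fin_numE// esum_ge0.
(* f is bounded, as its total variation is finite. *)
pose B := `|f (fun=> false)| + fine (\esum_(x in [set: S]) site_variation f x).
have f_B eta : `|f eta| <= B.
  rewrite -[f eta](subrK (f (fun=> false))) addrC (le_trans (ler_normD _ _))//.
  rewrite lerD2l -lee_fin fineK//.
  apply: (le_trans (config_variation_le _ _ f_continuous)).
  rewrite esum_mkcond; apply: le_esum => x _; by case: ifP.
pose a e := c e * edge_variation v e.
have ev0 := edge_variation_ge0 f_v.
have a0 e : 0 <= a e by rewrite mulr_ge0.
have a_lty : (\esum_(e in [set: edge S]) (a e)%:E < +oo)%E.
  apply: le_lt_trans f_rate_var; exact: esum_rate_variation.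
pose u := exclusion_term c f.
have u_a e eta : `|u e eta| <= a e.
  rewrite /u /exclusion_term normrM ger0_norm// ler_wpM2l//.
  exact: exchange_variation.
have u_cont e : continuous (u e) by exact: continuous_exclusion_term.
have [g Hg] := dominated_series a0 u_a a_lty.
have tail eps : 0 < eps -> exists F : {fset edge S},
    (\esum_(e in ~` [set` F]) (a e)%:E <= eps%:E)%E.
  move=> eps0; have [|F [_ HF]] := esum_tail _ a_lty eps0.
    by move=> e _; rewrite lee_fin.
  by exists F; rewrite -setTD.
have g_cont : continuous g.
  move=> eta; apply/cvgrPdist_le => eps eps0.
  have [|F HF] := tail (eps / 3); first by rewrite divr_gt0.
  have cF : continuous (fun sigma => \sum_(e <- F) u e sigma).
    apply: continuous_big => [|e _]; last exact: u_cont.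
    exact: add_continuous.
  have e3 : 0 < eps / 3 by rewrite divr_gt0.
  have := cF eta; move/cvgrPdist_le => /(_ _ e3).
  apply: filterS => sigma /=.
  have := le_trans (Hg F eta) HF; have := le_trans (Hg F sigma) HF.
  rewrite !lee_fin !ler_norml; lra.
have gen : generator_limit P f g.
  split=> //; apply/cvg_ereal0P => [t|eps eps0]; first exact: sup_norm_ge0.
  have e4 : 0 < eps / 4 by rewrite divr_gt0.
  have [F HF] := tail _ e4.
  have Gae := Gamma_star_ae c_ge0 c_rate P_poisson c_ne.
  have [C C0 HC] := semigroup_expansion c_ge0 c_rate P_poisson Gae
    f_continuous f_v f_rate_var f_B F.
  pose C' := C + \sum_(e <- F) (c e ^+ 2 * edge_variation v e).
  have C'0 : 0 <= C'.
    by rewrite addr_ge0// sumr_ge0// => e _; rewrite mulr_ge0 ?sqr_ge0.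
  (* The tail of the series enters twice, in the expansion and in g, each time
     for eps / 4; the choice of t makes the quadratic errors at most eps / 4. *)
  exists (eps / 4 / (C' + 1)) => /=; first by rewrite !divr_gt0// ltr_wpDl.
  move=> t /=; rewrite sub0r normrN => tsmall t0.
  have tC : C' * t <= eps / 4.
    have : t < eps / 4 / (C' + 1) := le_lt_trans (ler_norm _) tsmall.
    by rewrite ltr_pdivlMr ?ltr_wpDl// => h; nra.
  apply: sup_norm_le => eta.
  have h1 := HC t eta t0.
  set s := semigroup P t f eta in h1 *.
  set X := \sum_(e <- F) _ in h1.
  have h2 : `|s - f eta - X| <= t * (eps / 4) + C * t ^+ 2.
    rewrite -lee_fin EFinD EFinM; apply: (le_trans h1); apply: leeD => //.
    by rewrite lee_wpmul2l// lee_fin ltW.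
  (* The probability that e has jumped is c e * t up to (c e * t) ^+ 2. *)
  have h3 : `|X - t * \sum_(e <- F) u e eta| <=
      (\sum_(e <- F) (c e ^+ 2 * edge_variation v e)) * t ^+ 2.
    rewrite mulr_sumr -sumrB mulr_suml (le_trans (ler_norm_sum _ _ _))//.
    apply: ler_sum => e _; rewrite /u /exclusion_term mulrA -mulrBl normrM.
    rewrite (jumps_prob c_ge0 P_poisson)// ?(ltW t0)//= subr0.
    have -> : c e ^+ 2 * edge_variation v e * t ^+ 2 =
      (c e * t) ^+ 2 * edge_variation v e by ring.
    apply: ler_pM => //; last exact: exchange_variation.
    rewrite [t * c e]mulrC; apply: one_sub_expRN_approx.
    by rewrite mulr_ge0// ltW.
  have h4 : `|\sum_(e <- F) u e eta - g eta| <= eps / 4.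
    by rewrite -lee_fin; exact: le_trans (Hg F eta) HF.
  rewrite lee_fin; set Y := \sum_(e <- F) u e eta in h3 h4.
  have -> : (s - f eta) / t - g eta =
      (s - f eta - X) / t + (X - t * Y) / t + (Y - g eta).
    by field; rewrite gt_eqF.
  rewrite (le_trans (ler_normD _ _))//.
  have h5 : `|(s - f eta - X) / t + (X - t * Y) / t| <= eps / 4 + C' * t.
    have ti : `|t^-1| = t^-1 by rewrite gtr0_norm ?invr_gt0.
    rewrite -mulrDl normrM ti ler_pdivrMr//.
    rewrite (le_trans (ler_normD _ _))// (le_trans (lerD h2 h3))// /C'.
    by rewrite le_eqVlt (_ : _ == _ = true)//; apply/eqP; ring.
  by rewrite (le_trans (lerD h5 h4))//; lra.
split.
- by exists g.
- split=> //; apply: le_lt_trans a_lty; apply: le_esum => e _.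
  by apply: sup_norm_le => eta; rewrite lee_fin.
- rewrite /series_sum (generatorE gen); have FF := summability.totally_filter (I := edge S).
  apply/cvg_ereal0P => [F|eps eps0]; first exact: sup_norm_ge0.
  have [F HF] := tail _ eps0; exists F => // G /= FG.
  apply: sup_norm_le => eta; apply: (le_trans (Hg G eta)); apply: le_trans HF.
  rewrite esum_mkcond [leRHS]esum_mkcond; apply: le_esum => e _.
  case: ifPn; case: ifPn => //; rewrite ?lee_fin//.
  rewrite notin_setE inE/= => /contrapT eF nG; exfalso; apply: nG.
  exact: (fsubsetP FG).
Qed.
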